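(* Let $N\ge1$ be an integer and $\beta\ge 0$, and consider the ferromagnetic Ising model on the slab graph with vertex set $\mathbb{Z}^2\times\{0,1,\ldots,N-1\}$ at inverse temperature $\beta$, with zero external field and interaction $1$ on every edge. Let $\mu_+,\mu_-$ be its Gibbs measures with plus and minus boundary conditions. Then, for each choice of sign $\pm$, $$R(\mathbf{c}^{\pm};\mu_{\pm})>0\ \Longrightarrow\ |M(\mu_{\pm})|>0 .$$
   Context: The slab graph has vertex set $\mathbb{Z}^2\times\{0,1,\ldots,N-1\}$ and an edge between every two vertices at Euclidean distance one. Let $\Sigma^{(N)}=\{-1,+1\}^{\mathbb{Z}^2\times\{0,\ldots,N-1\}}$ with the $\sigma$-field generated by finite-dimensional cylinders. The measure $\mu_\pm$ on $\Sigma^{(N)}$ is the weak limit, as the finite box $B\uparrow\mathbb{Z}^2$, of the finite-volume Ising measures on $\Lambda=B\times\{0,\ldots,N-1\}$ with all spins outside $\Lambda$ (in the slab graph) equal to $\pm1$ and weights proportional to $\exp\{\beta\sum_{\langle x,y\rangle}\sigma_x\sigma_y\}$, the sum being over edges of the slab graph with at least one endpoint in $\Lambda$. Magnetization at the origin: $M(\mu_\pm)=\mathbb{E}_{\mu_\pm}(\sigma_{0,0,0})$. An $N$-vertex is a column $\mathbf{c}_{i,j}=((i,j,0),\ldots,(i,j,N-1))$ with $(i,j)\in\mathbb{Z}^2$. Two $N$-vertices $\mathbf{c}_{i,j},\mathbf{c}_{l,m}$ are joined by an $N$-edge when $(i,j)$ and $(l,m)$ are adjacent in $\mathbb{Z}^2$.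 For $\sigma\in\Sigma^{(N)}$, a $(\mathbf{c}^+)$-cluster (respectively $(\mathbf{c}^-)$-cluster) of $\sigma$ is a maximal connected (via $N$-edges) set of $N$-vertices $\mathbf{c}_{i,j}$ such that $\sum_{k=0}^{N-1}\sigma_{i,j,k}>0$ (respectively $<0$). The $N$-percolation probability is $$R(\mathbf{c}^\pm;\mu_\pm)=\mu_\pm(\{\sigma:\mathbf{c}_{0,0}\text{ belongs to an infinite }(\mathbf{c}^\pm)\text{-cluster of }\sigma\}),$$ with the same sign taken throughout. *)

(* Defs.v *)
From HB Require Import structures.
From mathcomp Require Import all_boot all_order all_algebra finmap.
From mathcomp Require Import all_classical all_reals all_analysis.
From mathcomp Require Import zify.

Set Implicit Arguments.
Unset Strict Implicit.
Unset Printing Implicit Defensive.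

Import Order.TTheory GRing.Theory Num.Theory.
Import numFieldNormedType.Exports.
Local Open Scope classical_set_scope.
Local Open Scope ring_scope.

Definition Z2 := (int * int)%type.

Definition Z2_origin : Z2 := (0, 0).

(* Euclidean distance one is tested on the square of the distance. *)
Definition Z2_adj (u v : Z2) : bool :=
  (u.1 - v.1) ^+ 2 + (u.2 - v.2) ^+ 2 == 1.

Definition vertex (N : nat) := (Z2 * 'I_N)%type.

Definition slab_adj (N : nat) (x y : vertex N) : bool :=
  (x.1.1 - y.1.1) ^+ 2 + (x.1.2 - y.1.2) ^+ 2 + (x.2%:Z - y.2%:Z) ^+ 2 == 1.

(* Unordered edges of the slab graph with at least one endpoint in
   B x {0, ..., N-1}. *)
Definition edges_meeting (N : nat) (B : {fset Z2}) : set {fset vertex N} :=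
  [set e | exists x y : vertex N,
    [/\ e = [fset x; y]%fset, slab_adj x y & (x.1 \in B) || (y.1 \in B)]].

(* Spins are encoded by booleans: true is +1 and false is -1. *)
Definition spin (R : realType) (b : bool) : R := if b then 1 else -1.

Definition config (N : nat) := vertex N -> bool.

Definition cylinder (N : nat) : set (set (config N)) :=
  [set A | exists F : {fset vertex N}, forall sigma tau : config N,
    (forall x, x \in F -> sigma x = tau x) -> A sigma -> A tau].

Definition config_space (N : nat) := g_sigma_algebraType (@cylinder N).

Section finite_volume.
Context (R : realType) (N : nat) (beta : R) (B : {fset Z2}) (s : bool).

Definition glue (eta : {ffun B * 'I_N -> bool}) : config N :=
  fun x => if insub x.1 is Some b then eta (b, x.2) else s.

(* The sum over edges is a finite one by finite_edges_meeting below. *)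
Definition boltzmann (sigma : config N) : R :=
  expR (beta * \sum_(e \in @edges_meeting N B) \prod_(x <- e) spin R (sigma x)).

Definition partition_function : R :=
  \sum_(eta : {ffun B * 'I_N -> bool}) boltzmann (glue eta).

Definition ising (A : set (config_space N)) : \bar R :=
  (\sum_(eta : {ffun B * 'I_N -> bool})
    (boltzmann (glue eta) / partition_function)%:E *
    \d_(glue eta : config_space N) A)%E.

Let partition_function_gt0 : 0 < partition_function.
Proof.
rewrite /partition_function (bigD1 [ffun=> s])//=.
by rewrite ltr_pwDl ?expR_gt0// sumr_ge0// => *; exact: expR_ge0.
Qed.

Let weight_ge0 eta : (0 <= (boltzmann (glue eta) / partition_function)%:E)%E.
Proof. by rewrite lee_fin divr_ge0 ?expR_ge0// ltW. Qed.

Let ising0 : ising set0 = 0%E.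
Proof. by rewrite /ising big1// => eta _; rewrite measure0 mule0. Qed.

Let ising_ge0 A : (0 <= ising A)%E.
Proof. by rewrite /ising sume_ge0// => eta _; rewrite mule_ge0. Qed.

Let ising_sigma_additive : semi_sigma_additive ising.
Proof.
move=> F mF tF mUF; rewrite [X in _ --> X](_ : _ =
    lim ((fun n => \sum_(0 <= i < n) ising (F i))%E @ \oo)).
  by apply: is_cvg_ereal_nneg_natsum => k _; exact: ising_ge0.
rewrite nneseries_sum//; last by move=> *; rewrite mule_ge0.
apply: eq_bigr => eta _; rewrite nneseriesZl//.
by rewrite measure_semi_bigcup.
Qed.

HB.instance Definition _ := isMeasure.Build _ _ _ ising
  ising0 ising_ge0 ising_sigma_additive.

Let ising_setT : ising setT = 1%E.
Proof.
rewrite /ising; under eq_bigr do rewrite diracT mule1.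
by rewrite sumEFin -mulr_suml divff// gt_eqF.
Qed.

HB.instance Definition _ := Measure_isProbability.Build _ _ _ ising ising_setT.

End finite_volume.

Lemma finite_edges_meeting (N : nat) (B : {fset Z2}) :
  finite_set (@edges_meeting N B).
Proof.
pose g (p : Z2 * 'I_N * (int * int * 'I_N)) : {fset vertex N} :=
  [fset p.1; ((p.1.1.1 + p.2.1.1, p.1.1.2 + p.2.1.2)%R, p.2.2)]%fset.
pose D : set int := [set` [:: 0; 1; -1]].
have fD : finite_set D by exact: finite_seq.
have sq1 (a b c : int) : a ^+ 2 + b ^+ 2 + c ^+ 2 = 1 -> D (- a) /\ D (- b).
  rewrite /D/= !inE; nia.
have : finite_set (g @` (([set` B] `*` [set: 'I_N]) `*`
    ((D `*` D) `*` [set: 'I_N]))).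
  by apply: finite_image; do !apply: finite_setX => //; exact: finite_finset.
apply: sub_finite_set.
have main (x y : vertex N) : slab_adj x y -> x.1 \in B ->
    (g @` (([set` B] `*` [set: 'I_N]) `*` ((D `*` D) `*` [set: 'I_N])))
      [fset x; y]%fset.
  move=> /eqP /sq1; rewrite !opprB => -[D1 D2] xB.
  exists (x, ((y.1.1 - x.1.1, y.1.2 - x.1.2), y.2)) => //=.
  by rewrite /g/= !(addrC x.1.1, addrC x.1.2) !subrK -!surjective_pairing.
move=> _ [x [y [-> xy /orP[xB|yB]]]]; first exact: main.
rewrite fsetUC; apply: main => //; move: xy; rewrite /slab_adj.
by rewrite -(sqrrN (x.1.1 - _)) -(sqrrN (x.1.2 - _)) -(sqrrN (x.2%:Z - _)) !opprB.
Qed.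

Definition weak_cvg (R : realType) (N : nat)
    (P_ : nat -> probability (config_space N) R)
    (P : probability (config_space N) R) : Prop :=
  forall f : config_space N -> R,
    continuous (f : {ptws vertex N -> bool} -> R) ->
    [bounded f sigma | sigma in [set: config_space N]] ->
    ('E_(P_ n)[f])%E @[n --> \oo] --> ('E_P[f])%E.

Definition is_box (B : {fset Z2}) : Prop :=
  exists a b c d : int, forall v : Z2,
    (v \in B) = (a <= v.1 <= b) && (c <= v.2 <= d).

Definition boxes_increase_to_Z2 (B_ : nat -> {fset Z2}) : Prop :=
  [/\ forall n, is_box (B_ n),
      forall n, (B_ n `<=` B_ n.+1)%fset &
      forall v, exists n, v \in B_ n].

(* mu is the infinite-volume state mu_+ (s = true) or mu_- (s = false). *)
Definition is_ising_state (R : realType) (N : nat) (beta : R) (s : bool)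
    (mu : probability (config_space N) R) : Prop :=
  forall B_ : nat -> {fset Z2}, boxes_increase_to_Z2 B_ ->
    weak_cvg (fun n => @ising R N beta (B_ n) s) mu.

Definition magnetization (R : realType) (N : nat) (hN : (0 < N)%N)
    (mu : probability (config_space N) R) : \bar R :=
  ('E_mu[fun sigma : config_space N =>
     spin R (sigma (Z2_origin, Ordinal hN))])%E.

(* The N-vertex c_(i,j) is represented by the point (i,j) of Z^2. *)
Definition column_sum (N : nat) (sigma : config N) (v : Z2) : int :=
  \sum_(k < N) (if sigma (v, k) then 1 else -1).

Definition signed_column (N : nat) (s : bool) (sigma : config N) (v : Z2) : bool :=
  if s then 0 < column_sum sigma v else column_sum sigma v < 0.

Definition N_connected (C : set Z2) : Prop :=
  forall u v, C u -> C v -> exists p : seq Z2,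
    [/\ path Z2_adj u p, last u p = v & forall w, w \in p -> C w].

Definition is_cluster (N : nat) (s : bool) (sigma : config N) (C : set Z2) : Prop :=
  [/\ C !=set0, C `<=` signed_column s sigma, N_connected C &
      forall C' : set Z2, C `<=` C' -> C' `<=` signed_column s sigma ->
        N_connected C' -> C' = C].

Definition N_percolation (R : realType) (N : nat) (s : bool)
    (mu : probability (config_space N) R) : \bar R :=
  mu [set sigma | exists C : set Z2,
    [/\ is_cluster s sigma C, C Z2_origin & infinite_set C]].

(* Main.v *)
Require Import Defs.
From HB Require Import structures.
From mathcomp Require Import all_boot all_order all_algebra finmap.
From mathcomp Require Import all_classical all_reals all_analysis.
From mathcomp Require Import zify ring lra.

Set Implicit Arguments.
Unset Strict Implicit.
Unset Printing Implicit Defensive.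

Import Order.TTheory GRing.Theory Num.Theory.
Import numFieldNormedType.Exports.
Local Open Scope ring_scope.

(** Suppose that the plus state percolates but has zero magnetization.

    Zero magnetization makes the plus state invariant under the spin flip.
    Indeed, the conditional law of a spin given its neighbours shows that the
    influence of the boundary condition vanishes at every site as soon as it
    vanishes at one ([gap_neighbor], [half_all]; without interaction there is no
    influence at all), and for an increasing event
    supported in a finite set this influence is bounded by the sum of the
    influences at the sites of that set ([flip_invariant]).  Hence columns with
    negative sum percolate exactly as columns with positive sum do.

    By the Markov property and monotonicity in the boundary condition, a large
    block is connected to far away with probability close to one
    ([reach_high]).  By positive association and the symmetries of the square,
    each of the eight half sides of the block is then likely to send out an arm
    of positive columns ([arm_high]), and, by the flip, one of negative columns.
    So with probability at least 1/2 the block has three positive arms and three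
    negative arms which alternate around it ([six_arms_high]).  In the plane, the
    negative arms keep the positive ones apart ([six_arms_separate], proved with
    the winding parity of a closed lattice walk).  Filling the block with plus
    spins costs a factor that does not depend on how far the arms reach, so a
    fixed block is, with probability bounded below, a trifurcation block: its
    removal splits its component into at least three parts that reach far away
    ([trifurcation_likely]).

    By translation invariance, of [M ^ 2] disjoint blocks in a box whose side
    is proportional to [M], on average at least a constant fraction are
    trifurcation blocks, whereas their number is at most that of the
    boundary points of the box ([count_trifurcations], the argument of Burton and
    Keane).  This is a contradiction for large [M] ([no_percolation]).  The
    claim for the minus state follows, as that state is the image of the plus
    state under the spin flip.

    The comparison, correlation and symmetry statements are proved in finite
    volume, where a Gibbs sum is an iterated sum over spins ([isum]) and all
    inequalities come from the four functions theorem ([four_functions]); they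
    pass to the limit on cylinder events. *)

(** * Iterated sums over spins and the four functions theorem *)

Section IteratedSum.
Context {V : eqType} {R : realType}.
Implicit Types (s t : V -> bool) (F G : (V -> bool) -> R) (l : seq V).

Definition upd s (x : V) (b : bool) : V -> bool :=
  fun y => if y == x then b else s y.

(** Finite-volume sums are written as iterated two-term sums over the sites
    of [l], the argument being the boundary condition off [l].  Every
    combinatorial identity for Gibbs sums becomes an induction on [l]. *)
Fixpoint isum l F s : R :=
  if l is x :: l' then isum l' F (upd s x true) + isum l' F (upd s x false)
  else F s.

Definition cfg_le s t := forall x, s x -> t x.
Definition cfg_or s t : V -> bool := fun x => s x || t x.
Definition cfg_and s t : V -> bool := fun x => s x && t x.

Lemma upd_same s x : upd s x (s x) = s.
Proof. by apply/funext => y; rewrite /upd; case: eqP => [->|]. Qed.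

Lemma upd_twice s x a b : upd (upd s x a) x b = upd s x b.
Proof. by apply/funext => y; rewrite /upd; case: eqP. Qed.

Lemma upd_comm s x y a b : x != y ->
  upd (upd s x a) y b = upd (upd s y b) x a.
Proof.
move=> xy; apply/funext => z; rewrite /upd; case: eqP => [->|//].
by rewrite eq_sym (negbTE xy).
Qed.

Lemma upd_or s t x a b : cfg_or (upd s x a) (upd t x b) = upd (cfg_or s t) x (a || b).
Proof. by apply/funext => y; rewrite /cfg_or /upd; case: eqP. Qed.

Lemma upd_and s t x a b :
  cfg_and (upd s x a) (upd t x b) = upd (cfg_and s t) x (a && b).
Proof. by apply/funext => y; rewrite /cfg_and /upd; case: eqP. Qed.

Lemma cfg_le_or s t : cfg_le s t -> cfg_or s t = t.
Proof.
move=> st; apply/funext => x; rewrite /cfg_or.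
by case E: (s x) => //=; rewrite (st x).
Qed.

Lemma cfg_le_and s t : cfg_le s t -> cfg_and s t = s.
Proof.
move=> st; apply/funext => x; rewrite /cfg_and.
by case E: (s x) => //=; rewrite (st x).
Qed.

Lemma eq_isum l F G s : F =1 G -> isum l F s = isum l G s.
Proof. by move=> /funext ->. Qed.

Lemma isum_cat l1 l2 F s : isum (l1 ++ l2) F s = isum l1 (isum l2 F) s.
Proof. by elim: l1 s => //= x l1 IH s; rewrite !IH. Qed.

Lemma isumD l F G s : isum l (fun u => F u + G u) s = isum l F s + isum l G s.
Proof. by elim: l s => //= x l IH s; rewrite !IH addrACA. Qed.

Lemma isumZ l (c : R) F s : isum l (fun u => c * F u) s = c * isum l F s.
Proof. by elim: l s => //= x l IH s; rewrite !IH mulrDr. Qed.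

Lemma ler_isum l F G s : (forall u, F u <= G u) -> isum l F s <= isum l G s.
Proof. by move=> FG; elim: l s => //= x l IH s; exact: lerD. Qed.

Lemma isum_ge0 l F s : (forall u, 0 <= F u) -> 0 <= isum l F s.
Proof. by move=> F0; elim: l s => //= x l IH s; exact: addr_ge0. Qed.

Lemma isum_gt0 l F s : (forall u, 0 < F u) -> 0 < isum l F s.
Proof. by move=> F0; elim: l s => //= x l IH s; exact: addr_gt0. Qed.

Lemma isum_pull l F G s :
  (forall u x b, x \in l -> G (upd u x b) = G u) ->
  isum l (fun u => F u * G u) s = isum l F s * G s.
Proof.
elim: l s => //= x l IH s Gl.
rewrite !IH => [|u y b yl|u y b yl]; try by rewrite Gl // inE yl orbT.
by rewrite !Gl ?mem_head // mulrDl.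
Qed.

Lemma isum_swap x l F s : isum (x :: l) F s = isum (rcons l x) F s.
Proof.
rewrite -cats1 isum_cat /=.
elim: l s => //= y l IH s; rewrite -!IH; case: (eqVneq x y) => [->|xy].
  by rewrite !upd_twice.
by rewrite addrACA !(@upd_comm _ x y).
Qed.

Lemma isum_perm l l' F s : perm_eq l l' -> isum l F s = isum l' F s.
Proof.
elim: l l' s => [|x l IH] l' s pll'.
  by rewrite perm_sym in pll'; rewrite (perm_nilP pll').
have xl' : x \in l' by rewrite -(perm_mem pll') mem_head.
case/splitPr: xl' pll' => p1 p2.
move=> pll'; have pl : perm_eq l (p1 ++ p2).
  by rewrite -(perm_cons x) (perm_trans pll') // -cat1s perm_catCA.
rewrite -cat_rcons isum_cat -isum_swap /= -!isum_cat.
by rewrite (IH (p1 ++ p2)) // (IH (p1 ++ p2)).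
Qed.

Lemma isum_agree l F s t : (forall x, x \notin l -> s x = t x) ->
  isum l F s = isum l F t.
Proof.
elim: l s t => [|x l IH] s t st /=; first by congr F; apply/funext => x; exact: st.
have agree b y : y \notin l -> upd s x b y = upd t x b y.
  by move=> yl; rewrite /upd; case: eqP => // /eqP yx; rewrite st // inE negb_or yx.
by rewrite !(IH _ _ (agree _)).
Qed.

Lemma isum_flip l F s :
  isum l F (fun x => ~~ s x) = isum l (fun u => F (fun x => ~~ u x)) s.
Proof.
have updN u x b : upd (fun y => ~~ u y) x b = (fun y => ~~ upd u x (~~ b) y).
  by apply/funext => y; rewrite /upd; case: eqP; rewrite ?negbK.
by elim: l s => //= x l IH s; rewrite !updN !IH addrC.
Qed.

Lemma isum_map (g g' : V -> V) l F s : cancel g g' -> cancel g' g ->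
  isum (map g l) F s = isum l (fun u => F (u \o g')) (s \o g).
Proof.
move=> gg' g'g; elim: l s => [|x l IH] s /=.
  by congr F; apply/funext => y /=; rewrite g'g.
have updg b : upd s (g x) b \o g = upd (s \o g) x b.
  by apply/funext => y; rewrite /upd /= (can_eq gg').
by rewrite !IH !updg.
Qed.

(** Only the cross terms need an argument: both are at most [c1 * d0], and by
    the first two inequalities their product is at most
    [(c1 * d0) * (c0 * d1)]; hence their sum is at most
    [c1 * d0 + c0 * d1]. *)
Lemma four_values (a1 a0 b1 b0 c1 c0 d1 d0 : R) :
  0 <= a1 -> 0 <= a0 -> 0 <= b1 -> 0 <= b0 ->
  0 <= c1 -> 0 <= c0 -> 0 <= d1 -> 0 <= d0 ->
  a1 * b1 <= c1 * d1 -> a0 * b0 <= c0 * d0 ->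
  a1 * b0 <= c1 * d0 -> a0 * b1 <= c1 * d0 ->
  (a1 + a0) * (b1 + b0) <= (c1 + c0) * (d1 + d0).
Proof.
move=> a10 a00 b10 b00 c10 c00 d10 d00 h11 h00 h10 h01.
suff : a1 * b0 + a0 * b1 <= c1 * d0 + c0 * d1.
  by move=> h; rewrite !mulrDl !mulrDr; lra.
have P0 : 0 <= c1 * d0 by exact: mulr_ge0.
have Q0 : 0 <= c0 * d1 by exact: mulr_ge0.
have x0 : 0 <= a1 * b0 by exact: mulr_ge0.
have y0 : 0 <= a0 * b1 by exact: mulr_ge0.
have xy : (a1 * b0) * (a0 * b1) <= (c1 * d0) * (c0 * d1).
  have -> : (a1 * b0) * (a0 * b1) = (a1 * b1) * (a0 * b0) by ring.
  have -> : (c1 * d0) * (c0 * d1) = (c1 * d1) * (c0 * d0) by ring.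
  by apply: ler_pM => //; exact: mulr_ge0.
move: (c1 * d0) (c0 * d1) (a1 * b0) (a0 * b1) P0 Q0 x0 y0 xy h10 h01.
move=> P Q x y P0 Q0 x0 y0 xy xP yP.
case: (ltrgt0P P) P0 => // [Pp _|P0 _]; last by lra.
have : 0 <= (P - x) * (P - y) by apply: mulr_ge0; lra.
move=> h; rewrite -(ler_pM2l Pp); nra.
Qed.

(** Ahlswede and Daykin: the hypothesis is stable under summing out one spin,
    by [four_values].  Allowing arbitrary boundary conditions in the
    conclusion gives the comparison of boundary conditions for free. *)
Lemma four_functions (l : seq V) (A B C D : (V -> bool) -> R) :
  (forall u, 0 <= A u) -> (forall u, 0 <= B u) ->
  (forall u, 0 <= C u) -> (forall u, 0 <= D u) ->
  (forall u v, A u * B v <= C (cfg_or u v) * D (cfg_and u v)) ->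
  forall s t, isum l A s * isum l B t
    <= isum l C (cfg_or s t) * isum l D (cfg_and s t).
Proof.
move=> A0 B0 C0 D0 h; elim: l => [|x l IH] s t //=.
apply: four_values; rewrite ?isum_ge0 //.
- by have := IH (upd s x true) (upd t x true); rewrite upd_or upd_and.
- by have := IH (upd s x false) (upd t x false); rewrite upd_or upd_and.
- by have := IH (upd s x true) (upd t x false); rewrite upd_or upd_and.
- by have := IH (upd s x false) (upd t x true); rewrite upd_or upd_and.
Qed.

End IteratedSum.

(** * Parity of closed lattice walks and separation of arms *)

Definition ball (k : int) : pred Z2 :=
  fun v => (- k <= v.1 <= k) && (- k <= v.2 <= k).

Definition linked (X : pred Z2) (u v : Z2) : Prop :=
  exists p : seq Z2, [/\ path Z2_adj u p, last u p = v & all X (u :: p)].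

Lemma Z2_adjP (u v : Z2) : Z2_adj u v =
  (u.1 == v.1) && ((u.2 == v.2 + 1) || (v.2 == u.2 + 1)) ||
  (u.2 == v.2) && ((u.1 == v.1 + 1) || (v.1 == u.1 + 1)).
Proof.
case: u v => a b [c d]; rewrite /Z2_adj /=.
apply/idP/idP => [/eqP H|]; last by nia.
have : a - c = 0 \/ b - d = 0 by nia.
by case=> E; rewrite E in H; nia.
Qed.

Lemma Z2_adj_sym : symmetric Z2_adj.
Proof. by move=> u v; rewrite !Z2_adjP; lia. Qed.

Lemma linked_refl (X : pred Z2) u : X u -> linked X u u.
Proof. by move=> Xu; exists [::]; rewrite /= Xu. Qed.

Lemma linked_trans (X : pred Z2) v u w : linked X u v -> linked X v w -> linked X u w.
Proof.
move=> [p [pp lp ap]] [q [pq lq aq]]; exists (p ++ q).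
rewrite cat_path last_cat lp pp pq lq; split=> //.
move: ap aq => /= /andP[-> ap] /andP[_ aq] /=; rewrite all_cat ap.
by move: aq => ->.
Qed.

Lemma linked_sym (X : pred Z2) u v : linked X u v -> linked X v u.
Proof.
move=> [p [pp lp ap]]; exists (rev (belast u p)); split.
- rewrite -lp rev_path (@eq_path _ _ Z2_adj) // => x y /=.
  exact: Z2_adj_sym.
- by case: p {pp ap} lp => [|x p] //= _; rewrite rev_cons last_rcons.
- have : all X (rcons (belast u p) v) by rewrite -lp -lastI.
  by rewrite all_rcons /= all_rev.
Qed.

Lemma linked_step (X : pred Z2) u v : X u -> X v -> Z2_adj u v -> linked X u v.
Proof. by move=> Xu Xv uv; exists [:: v]; rewrite /= Xu Xv uv. Qed.

Lemma linked_sub (X Y : pred Z2) u v : {subset X <= Y} -> linked X u v -> linked Y u v.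
Proof.
by move=> XY [p [pp lp ap]]; exists p; split=> //; apply: sub_all ap => x; exact: XY.
Qed.

Lemma linked_ends (X : pred Z2) u v : linked X u v -> X u /\ X v.
Proof.
move=> [p [_ <- /allP ap]]; split; apply: ap; rewrite ?mem_head //.
exact: mem_last.
Qed.

Lemma linked_ind (X : pred Z2) (P : Z2 -> Prop) u v :
  (forall x y, X x -> X y -> Z2_adj x y -> P x -> P y) ->
  linked X u v -> P u -> P v.
Proof.
move=> H [p [pp <- ap]]; elim: p u pp ap => [|x p IH] u //=.
move=> /andP[ux pp] /and3P[Xu Xx Xp] Pu; apply: (IH x) => //=.
  by rewrite Xx.
exact: H Pu.
Qed.

Lemma linked_line (X : pred Z2) (f : int -> Z2) (m n : int) : m <= n ->
  (forall i, Z2_adj (f i) (f (i + 1))) ->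
  (forall i, m <= i <= n -> X (f i)) -> linked X (f m) (f n).
Proof.
move=> mn fa; have -> : n = m + (`|n - m|%N)%:Z by lia.
elim: {n mn} (`|n - m|%N) => [|d IH] H.
  by rewrite addr0; apply: linked_refl; apply: H; lia.
apply: (@linked_trans _ (f (m + d%:Z))); first by apply: IH => i hi; apply: H; lia.
have -> : m + d.+1%:Z = m + d%:Z + 1 by lia.
by apply: linked_step => //; apply: H; lia.
Qed.

(** A block is connected: go horizontally to the column of the centre. *)
Lemma linked_ball k u v : ball k u -> ball k v -> linked (ball k) u v.
Proof.
have row x : ball k x -> linked (ball k) x (0, x.2).
  case: x => a b; rewrite /ball /= => hab.
  case: (lerP 0 a) => a0.
    apply: linked_sym; apply: (@linked_line _ (fun i => (i, b))) => //.
      by move=> i; rewrite Z2_adjP /=; lia.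
    by move=> i hi; rewrite /ball /=; lia.
  apply: (@linked_line _ (fun i => (i, b))); first exact: ltW.
    by move=> i; rewrite Z2_adjP /=; lia.
  by move=> i hi; rewrite /ball /=; lia.
have col (b c : int) : b <= c -> - k <= b -> c <= k -> linked (ball k) (0, b) (0, c).
  move=> bc hb hc; apply: (@linked_line _ (fun i => (0, i))) => //.
    by move=> i; rewrite Z2_adjP /=; lia.
  by move=> i hi; rewrite /ball /=; lia.
move=> hu hv; apply: linked_trans (row u hu) _; apply: linked_trans (linked_sym (row v hv)).
move: hu hv; rewrite /ball => hu hv.
case: (lerP u.2 v.2) => uv; first by apply: col; lia.
by apply: linked_sym; apply: col; lia.
Qed.

Section WalkParity.

Fixpoint walk_parity (f : Z2 -> Z2 -> bool) (u : Z2) (p : seq Z2) : bool :=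
  if p is v :: p' then f u v (+) walk_parity f v p' else false.

Lemma walk_parity_cat f u p q :
  walk_parity f u (p ++ q) = walk_parity f u p (+) walk_parity f (last u p) q.
Proof. by elim: p u => //= v p IH u; rewrite IH addbA. Qed.

Lemma walk_parity_addb f g u p :
  walk_parity (fun x y => f x y (+) g x y) u p
  = walk_parity f u p (+) walk_parity g u p.
Proof. by elim: p u => //= v p IH u; rewrite IH addbACA. Qed.

Lemma walk_parity_tele (h : Z2 -> bool) u p :
  walk_parity (fun x y => h x (+) h y) u p = h u (+) h (last u p).
Proof. by elim: p u => [|v p IH] u /=; rewrite ?addbb // IH addbA addbK. Qed.

Lemma eq_walk_parity f g u p : path Z2_adj u p ->
  (forall x y, Z2_adj x y -> f x y = g x y) ->
  walk_parity f u p = walk_parity g u p.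
Proof. by elim: p u => //= v p IH u /andP[uv pv] fg; rewrite fg // IH. Qed.

Lemma walk_parity0 (X : pred Z2) f u p : all X (u :: p) ->
  (forall x y, X x -> X y -> f x y = false) -> walk_parity f u p = false.
Proof.
by elim: p u => //= v p IH u /and3P[Xu Xv Xp] f0; rewrite f0 // IH //= Xv.
Qed.

Definition up_edge (a b : int) (u v : Z2) : bool :=
  (u.1 == a) && (v.1 == a) &&
  ((u.2 == b) && (v.2 == b + 1) || (v.2 == b) && (u.2 == b + 1)).

Definition right_edge (a b : int) (u v : Z2) : bool :=
  (u.2 == b) && (v.2 == b) &&
  ((u.1 == a) && (v.1 == a + 1) || (v.1 == a) && (u.1 == a + 1)).

(** The edges met by the horizontal ray going right from the centre of the
    unit face whose lower left corner is [(a, b)].  For a closed walk the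
    parity of their number is the winding number mod 2 around that face. *)
Definition ray_edge (a b : int) (u v : Z2) : bool :=
  (u.1 == v.1) && (a < u.1) &&
  ((u.2 == b) && (v.2 == b + 1) || (v.2 == b) && (u.2 == b + 1)).

Lemma ray_edge_left a b u v :
  ray_edge (a - 1) b u v (+) ray_edge a b u v = up_edge a b u v.
Proof. by case: u v => [x y] [z t]; rewrite /ray_edge /up_edge /=; lia. Qed.

(** The right-hand side is the coboundary of the indicator of the open ray
    strictly to the right of [(a, b)], so it cancels on closed walks. *)
Lemma ray_edge_down a b u v : Z2_adj u v ->
  ray_edge a (b - 1) u v (+) ray_edge a b u v (+) right_edge a b u v =
  ((a < u.1) && (u.2 == b)) (+) ((a < v.1) && (v.2 == b)).
Proof.
rewrite Z2_adjP; case: u v => [x y] [z t]; rewrite /ray_edge /right_edge /=.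
move=> /orP[/andP[/eqP -> /orP[]/eqP ->]|/andP[/eqP -> /orP[]/eqP ->]].
- rewrite eqxx /=; case: (a < z) => /=; last by lia.
  by case: (eqVneq t b); case: (eqVneq (t + 1) b); lia.
- rewrite eqxx /=; case: (a < z) => /=; last by lia.
  by case: (eqVneq y b); case: (eqVneq (y + 1) b); lia.
- rewrite (_ : z + 1 == z = false); last by lia.
  case: (eqVneq t b) => /= _; last by lia.
  by case: (eqVneq z a); lia.
- rewrite (_ : x == x + 1 = false); last by lia.
  case: (eqVneq t b) => /= _; last by lia.
  by case: (eqVneq x a); lia.
Qed.

Lemma walk_parity_left a b u p :
  walk_parity (ray_edge (a - 1) b) u p (+) walk_parity (ray_edge a b) u p
  = walk_parity (up_edge a b) u p.
Proof.
rewrite -walk_parity_addb; elim: p u => //= v p IH u.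
by rewrite ray_edge_left IH.
Qed.

Lemma walk_parity_down a b u p : path Z2_adj u p -> last u p = u ->
  walk_parity (ray_edge a (b - 1)) u p (+) walk_parity (ray_edge a b) u p
  = walk_parity (right_edge a b) u p.
Proof.
move=> pp lp.
have := @walk_parity_tele (fun x => (a < x.1) && (x.2 == b)) u p.
rewrite lp addbb => tele.
have := eq_walk_parity pp (@ray_edge_down a b).
rewrite tele !walk_parity_addb.
by case: walk_parity; case: walk_parity; case: walk_parity.
Qed.

End WalkParity.

Lemma ring_right k j : - k <= j <= k ->
  [/\ ball k (k, j), ~~ ball k (k + 1, j) &
    forall w, Z2_adj (k + 1, j) w -> ball k w -> w = (k, j)].
Proof.
move=> jk; rewrite /ball; split=> [/=|/=|[c d]]; [lia|lia|].
by rewrite Z2_adjP /= => H1 H2; congr (_, _); lia.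
Qed.

Lemma ring_top k i : - k <= i <= k ->
  [/\ ball k (i, k), ~~ ball k (i, k + 1) &
    forall w, Z2_adj (i, k + 1) w -> ball k w -> w = (i, k)].
Proof.
move=> ik; rewrite /ball; split=> [/=|/=|[c d]]; [lia|lia|].
by rewrite Z2_adjP /= => H1 H2; congr (_, _); lia.
Qed.

Lemma ring_left k j : - k <= j <= k ->
  [/\ ball k (- k, j), ~~ ball k (- k - 1, j) &
    forall w, Z2_adj (- k - 1, j) w -> ball k w -> w = (- k, j)].
Proof.
move=> jk; rewrite /ball; split=> [/=|/=|[c d]]; [lia|lia|].
by rewrite Z2_adjP /= => H1 H2; congr (_, _); lia.
Qed.

Section Loop.
Variables (k r : int) (X : pred Z2) (u v u' v' : Z2).
Hypotheses (k0 : 0 <= k) (kr : k < r).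
Hypothesis Xout : forall x, X x -> ~~ ball k x.
Hypothesis Xin : forall x, X x -> ball r x.
Hypothesis uv : linked X u v.
Hypotheses (u'k : ball k u') (v'k : ball k v').
Hypotheses (uu' : Z2_adj u u') (vv' : Z2_adj v v').

Definition spoke (y : Z2) : bool := (y == u) (+) (y == v).

(** A path outside the block from [u] to [v], closed up through the block,
    gives a winding parity that changes around the block exactly at the two
    edges by which the loop enters the block, however it runs inside. *)
Lemma loop_parity : exists I : int -> int -> bool,
  [/\ forall j, - k <= j <= k -> I k (j - 1) (+) I k j = spoke (k + 1, j),
      forall i, - k <= i <= k -> I (i - 1) k (+) I i k = spoke (i, k + 1),
      forall j, - k <= j <= k ->
        I (- k - 1) (j - 1) (+) I (- k - 1) j = spoke (- k - 1, j),
      (forall w, ~~ X w -> ~~ ball k w ->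
        I (w.1 - 1) w.2 = I w.1 w.2 /\ I w.1 (w.2 - 1) = I w.1 w.2) &
      forall (Y : pred Z2) w w', (forall x, Y x -> ~~ X x /\ ~~ ball k x) ->
        linked Y w w' -> ~~ ball r w' -> I w.1 w.2 = false].
Proof.
have [p [pp lp Xp]] := uv.
have [q [pq lq kq]] := linked_ball v'k u'k.
have [Xu Xv] := linked_ends uv.
pose g := p ++ v' :: rcons q u.
have pg : path Z2_adj u g.
  by rewrite cat_path lp /= pp vv' rcons_path pq lq Z2_adj_sym uu'.
have lg : last u g = u by rewrite last_cat /= last_rcons.
pose I a b := walk_parity (ray_edge a b) u g.
have Il a b : I (a - 1) b (+) I a b = walk_parity (up_edge a b) u g.
  exact: walk_parity_left.
have Id a b : I a (b - 1) (+) I a b = walk_parity (right_edge a b) u g.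
  exact: walk_parity_down.
have gXk x : x \in u :: g -> X x || ball k x.
  rewrite -cat_cons mem_cat => /orP[/(allP Xp) -> //|].
  rewrite -rcons_cons mem_rcons inE => /orP[/eqP->|/(allP kq) ->].
    by rewrite Xu.
  by rewrite orbT.
have wg f : (forall x y, X x -> X y -> f x y = false) ->
    (forall x y, ball k x -> ball k y -> f x y = false) ->
    walk_parity f u g = f v v' (+) f u' u.
  move=> fX fk; rewrite walk_parity_cat (walk_parity0 Xp fX) lp /= -cats1.
  by rewrite walk_parity_cat (walk_parity0 kq fk) lq /= addbF.
(* no step of the loop has an end at a point off the loop *)
have goff (f : Z2 -> Z2 -> bool) w : ~~ X w -> ~~ ball k w ->
    (forall x y, f x y -> w = x \/ w = y) -> walk_parity f u g = false.
  move=> wX wk fw; have wg' x : x \in u :: g -> w != x.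
    move=> /gXk; apply: contraL => /eqP <-; by rewrite negb_or wX.
  apply: (@walk_parity0 (fun x => w != x)); first exact/allP.
  move=> x y /eqP wx /eqP wy; apply/negP => /fw[].
    exact: wx.
  exact: wy.
have edge_off (f : Z2 -> Z2 -> bool) e1 e2 :
    (forall x y, f x y = (x == e1) && (y == e2) || (y == e1) && (x == e2)) ->
    (forall w, ~~ X w -> ~~ ball k w -> w = e1 \/ w = e2 -> walk_parity f u g = false) /\
    (ball k e1 -> ~~ ball k e2 -> (forall w, Z2_adj e2 w -> ball k w -> w = e1) ->
      walk_parity f u g = spoke e2).
  move=> fE; split.
    move=> w wX wk we; apply: (goff _ w) => // x y; rewrite fE.
    by move=> /orP[]/andP[/eqP -> /eqP ->]; case: we; auto.
  move=> e1k e2k e12.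
  have fv z z' : Z2_adj z z' -> X z -> ball k z' -> f z z' = (z == e2).
    move=> zz Xz kz'; rewrite fE.
    have -> : z == e1 = false by apply/eqP => E; have := Xout Xz; rewrite E e1k.
    rewrite /=; case: (eqVneq z e2) => E; last by rewrite andbF.
    by rewrite andbT; apply/eqP; apply: e12 => //; rewrite -E.
  have fC z z' : f z z' = f z' z by rewrite !fE orbC.
  rewrite wg; first by rewrite fv // (fC u') fv // addbC /spoke !(eq_sym e2).
    move=> x y Xx Xy; rewrite fE; apply/negP.
    by move=> /orP[]/andP[/eqP E /eqP _]; move: e1k; apply/negP; rewrite -E Xout.
  move=> x y Xx Xy; rewrite fE; apply/negP.
  by move=> /orP[]/andP[/eqP _ /eqP E]; move: e2k; rewrite -E ?Xx ?Xy.
have up_edgeE a b x y : up_edge a b x y =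
    (x == (a, b)) && (y == (a, b + 1)) || (y == (a, b)) && (x == (a, b + 1)).
  case: x y => [x1 x2] [y1 y2]; rewrite /up_edge !xpair_eqE /=.
  by do 6! case: (_ == _).
have right_edgeE a b x y : right_edge a b x y =
    (x == (a, b)) && (y == (a + 1, b)) || (y == (a, b)) && (x == (a + 1, b)).
  case: x y => [x1 x2] [y1 y2]; rewrite /right_edge !xpair_eqE /=.
  by do 6! case: (_ == _).
have right_edgeE' a b x y : right_edge (a - 1) b x y =
    (x == (a, b)) && (y == (a - 1, b)) || (y == (a, b)) && (x == (a - 1, b)).
  by rewrite right_edgeE subrK orbC andbC; congr (_ || _); rewrite andbC.
have addb_eq (c d : bool) : c (+) d = false -> c = d by case: c; case: d.
have Iout w : ~~ X w -> ~~ ball k w ->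
    I (w.1 - 1) w.2 = I w.1 w.2 /\ I w.1 (w.2 - 1) = I w.1 w.2.
  case: w => a b wX wk; split; apply: addb_eq; rewrite ?Il ?Id.
    by have [+ _] := edge_off _ _ _ (up_edgeE a b); apply; [exact: wX| |left].
  by have [+ _] := edge_off _ _ _ (right_edgeE a b); apply; [exact: wX| |left].
exists I; split=> //.
- move=> j jk; rewrite Id; have [h1 h2 h3] := ring_right jk.
  by have [_ ->] := edge_off _ _ _ (right_edgeE k j).
- move=> i ik; rewrite Il; have [h1 h2 h3] := ring_top ik.
  by have [_ ->] := edge_off _ _ _ (up_edgeE i k).
- move=> j jk; rewrite Id; have [h1 h2 h3] := ring_left jk.
  by have [_ ->] := edge_off _ _ _ (right_edgeE' (- k) j).
- move=> Y w w' YX ww' w'r.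
  have -> : I w.1 w.2 = I w'.1 w'.2.
    apply: (@linked_ind Y (fun z => I w.1 w.2 = I z.1 z.2) w w') => //.
    move=> [x1 x2] [y1 y2] /YX[Xx kx] /YX[Xy ky] xy ->.
    have /= [Hx1 Hx2] := Iout _ Xx kx; have /= [Hy1 Hy2] := Iout _ Xy ky.
    move: xy; rewrite Z2_adjP /=.
    move=> /orP[/andP[/eqP E /orP[]/eqP E']|/andP[/eqP E /orP[]/eqP E']]; subst.
    + by move: Hx2; rewrite addrK.
    + by move: Hy2; rewrite addrK.
    + by move: Hx1; rewrite addrK.
    + by move: Hy1; rewrite addrK.
  have gr x : x \in u :: g -> ball r x.
    by move=> /gXk /orP[/Xin //|]; rewrite /ball; move: kr; clear; lia.
  (* rays that start beyond the ball of radius r on the right, or run above or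
     below it, miss the loop; on the left go up to such a height first *)
  have far a b : (forall x, ball r x -> a < x.1 -> x.2 != b /\ x.2 != b + 1) ->
      I a b = false.
    move=> H; apply: (@walk_parity0 (ball r)); first by apply/allP.
    move=> x y xr yr; rewrite /ray_edge; case: (ltrP a x.1) => ax; last by rewrite andbF.
    have [/negbTE -> /negbTE ->] := H x xr ax; by rewrite /= !andbF.
  have high a : I a (r + 1) = false.
    by apply: far => x; rewrite /ball; clear; lia.
  have offr x : ~~ ball r x -> ~~ X x /\ ~~ ball k x.
    move=> xr; split; first exact: contra (@Xin _) xr.
    by move: xr kr; rewrite /ball; clear; lia.
  case: w' w'r {ww'} => a b /= abr.
  case: (boolP (- r <= b <= r)) => [br|br]; last first.
    have [aX ak] := offr _ abr; have [_ /= abE] := Iout _ aX ak.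
    case: (ltrP b 0) => b0.
      by rewrite -abE; apply: far => x; move: b0 br kr k0; rewrite /ball; clear; lia.
    by apply: far => x; move: b0 br kr k0; rewrite /ball; clear; lia.
  case: (lerP a r) => ar; last by apply: far => x; move: ar; rewrite /ball; clear; lia.
  have {}ar : a < - r by move: abr br ar; rewrite /ball /=; clear; lia.
  have col d : I a (b + d%:Z) = I a b.
    elim: d => [|d <-]; first by rewrite addr0.
    have [|aX ak] := offr (a, b + d.+1%:Z).
      by move: ar; rewrite /ball /=; clear; lia.
    have [_ /= <-] := Iout _ aX ak; congr (I _ _); clear; lia.
  rewrite -(col (absz (r + 1 - b)%R)) -(high a); congr (I _ _); move: br; clear; lia.
Qed.

End Loop.

(** The next two lemmas follow a winding parity along one side of the block. *)
Lemma parity_const (f sp : int -> bool) (m n : int) : m <= n ->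
  (forall j, m < j <= n -> f (j - 1) (+) f j = sp j) ->
  (forall j, m < j <= n -> sp j = false) -> f m = f n.
Proof.
move=> mn; have -> : n = m + (absz (n - m)%R)%:Z by lia.
elim: {n mn} (absz _) => [|d IH] H sp0; first by rewrite addr0.
rewrite IH => [|j hj|j hj]; [|by apply: H; lia|by apply: sp0; lia].
have := H (m + d.+1%:Z); rewrite sp0; last by lia.
rewrite (_ : m + d.+1%:Z - 1 = m + d%:Z); last by lia.
by move=> h; move: (h ltac:(lia)); case: (f _); case: (f _).
Qed.

Lemma parity_once (f sp : int -> bool) (m n j0 : int) : m < j0 <= n ->
  (forall j, m < j <= n -> f (j - 1) (+) f j = sp j) ->
  (forall j, m < j <= n -> sp j = (j == j0)) -> f m = ~~ f n.
Proof.
move=> j0mn H sp1; rewrite (@parity_const f sp m (j0 - 1)).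
- rewrite -(@parity_const f sp j0 n); last 1 first.
  + by move=> j hj; rewrite sp1; lia.
  + by have := H j0 j0mn; rewrite sp1 // eqxx; case: (f _); case: (f _).
  + by lia.
  + by move=> j hj; apply: H; lia.
- by lia.
- by move=> j hj; apply: H; lia.
- by move=> j hj; rewrite sp1; lia.
Qed.

Definition off_ball (S : pred Z2) (k : int) : pred Z2 :=
  fun x => S x && ~~ ball k x.

Definition annulus (S : pred Z2) (k r : int) : pred Z2 :=
  fun x => S x && ~~ ball k x && ball r x.

(** Going around the block from the right side over the top to the left
    side, one meets alternately three starting points of paths of [P] and three
    of arms of [M].  An arm of [M] reaches the outside without crossing a loop
    made of [P], so the winding parity vanishes next to its starting point;
    but this parity flips once between the two [M]-arms chosen around one end
    of a [P]-path. *)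
Lemma six_arms_separate (k r : int) (P M : pred Z2)
    (y1 y2 x3 x4 y5 y6 : int) (w2 w4 w6 : Z2) :
  0 <= k -> k < r -> (forall x, P x -> ~~ M x) ->
  - k <= y1 <= 0 -> 0 <= y2 <= k -> 0 <= x3 <= k ->
  - k <= x4 <= 0 -> 0 <= y5 <= k -> - k <= y6 <= 0 ->
  linked (off_ball M k) (k + 1, y2) w2 -> ~~ ball r w2 ->
  linked (off_ball M k) (x4, k + 1) w4 -> ~~ ball r w4 ->
  linked (off_ball M k) (- k - 1, y6) w6 -> ~~ ball r w6 ->
  [/\ ~ linked (annulus P k r) (k + 1, y1) (x3, k + 1),
      ~ linked (annulus P k r) (x3, k + 1) (- k - 1, y5) &
      ~ linked (annulus P k r) (k + 1, y1) (- k - 1, y5)].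
Proof.
move=> k0 kr PM hy1 hy2 hx3 hx4 hy5 hy6 l2 o2 l4 o4 l6 o6.
have Xout x : annulus P k r x -> ~~ ball k x by case/andP=> /andP[].
have Xin x : annulus P k r x -> ball r x by case/andP.
have YX x : off_ball M k x -> ~~ annulus P k r x /\ ~~ ball k x.
  move=> /andP[Mx kx]; split=> //; apply/negP => /andP[/andP[/PM]].
  by rewrite Mx.
have neq (x y : Z2) w z : linked (off_ball M k) x w -> linked (annulus P k r) y z ->
    x != y /\ x != z.
  move=> /linked_ends[/YX[+ _] _] /linked_ends[+ +] => Xx Xy Xz.
  by split; apply: contraNneq Xx => ->.
have j1 : - k <= y1 <= k by clear -hy1 k0; lia.
have j3 : - k <= x3 <= k by clear -hx3 k0; lia.
have j5 : - k <= y5 <= k by clear -hy5 k0; lia.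
have [b1 _ _] := ring_right j1; have [b3 _ _] := ring_top j3.
have [b5 _ _] := ring_left j5.
have a1 : Z2_adj (k + 1, y1) (k, y1) by rewrite Z2_adjP /=; clear; lia.
have a3 : Z2_adj (x3, k + 1) (x3, k) by rewrite Z2_adjP /=; clear; lia.
have a5 : Z2_adj (- k - 1, y5) (- k, y5) by rewrite Z2_adjP /=; clear; lia.
split=> uv.
- have [I [IR IT IL Ioff Iarm]] := loop_parity k0 kr Xout Xin uv b1 b3 a1 a3.
  have I2 := Iarm _ _ _ YX l2 o2; have I4 := Iarm _ _ _ YX l4 o4.
  have [[n21 n23] [n41 n43]] := (neq _ _ _ _ l2 uv, neq _ _ _ _ l4 uv).
  have [/YX[X2 k2] _] := linked_ends l2; have [/YX[X4 k4] _] := linked_ends l4.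
  have [J2 _] := Ioff _ X2 k2; have [_ J4] := Ioff _ X4 k4.
  rewrite /= I2 addrK in J2; rewrite /= I4 addrK in J4.
  have C1 : I k y2 = I k k.
    apply: (@parity_const _ (fun j => spoke (k + 1, y1) (x3, k + 1) (k + 1, j))).
    + by clear -hy2; lia.
    + by move=> j hj; apply: IR; clear -hj hy2 k0; lia.
    + move=> j hj; rewrite /spoke !xpair_eqE; clear -hj hy2 hy1 hx3; lia.
  have C2 : I x4 k = ~~ I k k.
    apply: (@parity_once (I^~ k) (fun i => spoke (k + 1, y1) (x3, k + 1) (i, k + 1)) _ _ x3).
    + move: n43; rewrite xpair_eqE; clear -hx3 hx4; lia.
    + by move=> j hj; apply: IT; clear -hj hx4 k0; lia.
    + move=> j hj; rewrite /spoke !xpair_eqE; clear -hj hx4 hx3; lia.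
  by move: C2; rewrite -C1 J2 J4.
- have [I [IR IT IL Ioff Iarm]] := loop_parity k0 kr Xout Xin uv b3 b5 a3 a5.
  have I6 := Iarm _ _ _ YX l6 o6; have I4 := Iarm _ _ _ YX l4 o4.
  have [[n61 n63] [n41 n43]] := (neq _ _ _ _ l6 uv, neq _ _ _ _ l4 uv).
  have [/YX[X4 k4] _] := linked_ends l4.
  have [_ J4] := Ioff _ X4 k4.
  rewrite /= in I6; rewrite /= I4 addrK in J4.
  have C1 : I (- k - 1) k = I x4 k.
    apply: (@parity_const (I^~ k) (fun i => spoke (x3, k + 1) (- k - 1, y5) (i, k + 1))).
    + by clear -hx4; lia.
    + by move=> j hj; apply: IT; clear -hj hx4 k0; lia.
    + move: n41; rewrite xpair_eqE => n41.
      move=> j hj; rewrite /spoke !xpair_eqE; clear -hj hx4 hx3 hy5 n41; lia.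
  have C2 : I (- k - 1) y6 = ~~ I (- k - 1) k.
    apply: (@parity_once _ (fun j => spoke (x3, k + 1) (- k - 1, y5) (- k - 1, j)) _ _ y5).
    + move: n63; rewrite xpair_eqE; clear -hy5 hy6; lia.
    + by move=> j hj; apply: IL; clear -hj hy6 k0; lia.
    + move=> j hj; rewrite /spoke !xpair_eqE; clear -hj hy5 hy6 hx3 k0; lia.
  by move: C2; rewrite C1 I6 J4.
- have [I [IR IT IL Ioff Iarm]] := loop_parity k0 kr Xout Xin uv b1 b5 a1 a5.
  have I6 := Iarm _ _ _ YX l6 o6; have I2 := Iarm _ _ _ YX l2 o2.
  have [n61 n63] := neq _ _ _ _ l6 uv.
  have [/YX[X2 k2] _] := linked_ends l2.
  have [J2 _] := Ioff _ X2 k2.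
  rewrite /= in I6; rewrite /= I2 addrK in J2.
  have C1 : I k y2 = I k k.
    apply: (@parity_const _ (fun j => spoke (k + 1, y1) (- k - 1, y5) (k + 1, j))).
    + by clear -hy2; lia.
    + by move=> j hj; apply: IR; clear -hj hy2 k0; lia.
    + have [n21 _] := neq _ _ _ _ l2 uv; move: n21; rewrite xpair_eqE => n21.
      move=> j hj; rewrite /spoke !xpair_eqE; clear -hj hy2 hy1 k0 n21; lia.
  have C3 : I (- k - 1) k = I k k.
    apply: (@parity_const (I^~ k) (fun i => spoke (k + 1, y1) (- k - 1, y5) (i, k + 1))).
    + by clear -k0; lia.
    + by move=> j hj; apply: IT; clear -hj k0; lia.
    + move=> j hj; rewrite /spoke !xpair_eqE; clear -hj k0; lia.
  have C2 : I (- k - 1) y6 = ~~ I (- k - 1) k.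
    apply: (@parity_once _ (fun j => spoke (k + 1, y1) (- k - 1, y5) (- k - 1, j)) _ _ y5).
    + move: n63; rewrite xpair_eqE; clear -hy5 hy6; lia.
    + by move=> j hj; apply: IL; clear -hj hy6 k0; lia.
    + move=> j hj; rewrite /spoke !xpair_eqE; clear -hj hy5 hy6 k0; lia.
  by move: C2; rewrite C3 I6 -C1 J2.
Qed.

(** * Counting trifurcation blocks *)

Section Trifurcation.
Variables (V : finType) (adj : rel V).
Hypothesis adj_sym : symmetric adj.
Implicit Types (G X : {set V}).

Definition within X : rel V := fun x y => [&& adj x y, x \in X & y \in X].
Definition branch X (u : V) : {set V} := [set v | connect (within X) u v].

Lemma within_sym X : connect_sym (within X).
Proof.
by apply: sym_connect_sym => x y; rewrite /within adj_sym; congr (_ && _); exact: andbC.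
Qed.

Lemma branch_refl X u : u \in branch X u.
Proof. by rewrite inE. Qed.

Lemma branch_sub X u : u \in X -> branch X u \subset X.
Proof.
move=> uX; apply/fintype.subsetP => v; rewrite inE => /connectP[p + ->].
elim: p u uX => //= w p IH u uX /andP[/and3P[_ _ wX]]; exact: IH.
Qed.

Lemma branch_eq X u v : v \in branch X u -> branch X v = branch X u.
Proof.
rewrite inE => uv; apply/setP => w; rewrite !inE.
by rewrite (same_connect (within_sym X) uv).
Qed.

Lemma branch_disj X u v w : w \in branch X u -> w \in branch X v ->
  branch X u = branch X v.
Proof. by move=> /branch_eq <- /branch_eq <-. Qed.

Lemma branch_mono X X' u : X \subset X' -> branch X u \subset branch X' u.
Proof.
move=> /fintype.subsetP XX'; apply/fintype.subsetP => v; rewrite !inE.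
apply: connect_sub => x y /and3P[xy xX yX]; apply: connect1.
by rewrite /within xy !XX'.
Qed.

(** Applied to complements of two different blocks: removing a block does not
    disturb the branches that avoid it. *)
Lemma branch_avoid X X' u : u \in X -> branch X u \subset X' -> branch X u \subset branch X' u.
Proof.
move=> uX sub; apply/fintype.subsetP => v; rewrite !inE => /connectP[p pp ->].
have : forall w, w \in branch X u -> path (within X) w p -> connect (within X') w (last w p).
  elim: p {pp v} => [|x p IH] w wB /=; first by rewrite connect0.
  move=> /andP[wx pp]; have xB : x \in branch X u.
    by move: wB; rewrite !inE => /connect_trans; apply; exact: connect1.
  apply: connect_trans (IH x xB pp); apply: connect1.
  case/and3P: wx => wx _ _; rewrite /within wx.
  by rewrite !(fintype.subsetP sub).
by apply => //; exact: branch_refl.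
Qed.

Lemma branch_step X u v w : v \in branch X u -> v \in X -> w \in X -> adj v w ->
  w \in branch X u.
Proof.
rewrite !inE => uv vX wX vw; apply: connect_trans uv _; apply: connect1.
by rewrite /within vw vX.
Qed.

Section Count.
Variables (I : eqType) (G : {set V}) (b : I -> {set V}).

Definition opens t (Y : {set V}) u : bool :=
  [&& u \in G :\: b t, [exists w, (w \in b t) && adj w u] &
      ~~ [disjoint branch (G :\: b t) u & Y]].

Definition trifurcates t (Y : {set V}) : Prop := exists u1 u2 u3,
  [/\ opens t Y u1, opens t Y u2, opens t Y u3 &
      [/\ branch (G :\: b t) u1 != branch (G :\: b t) u2,
          branch (G :\: b t) u2 != branch (G :\: b t) u3 &
          branch (G :\: b t) u1 != branch (G :\: b t) u3]].

Hypothesis b_sub : forall t, b t \subset G.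
Hypothesis b_conn : forall t x y, x \in b t -> y \in b t -> y \in branch (b t) x.
Hypothesis b_disj : forall t t', t != t' -> [disjoint b t & b t'].

(** Burton and Keane: among all branches behind blocks of [T] take a smallest
    one, [B], behind [t].  By minimality the branches behind another block
    [t'] that avoid [t] are disjoint from [B]; a branch behind [t'] that
    contains [t] also contains a branch behind [t] other than [B].  Hence [t']
    still trifurcates towards [Y] minus [B], and [t] is paid for by a point of
    [Y] in [B]. *)
Lemma count_trifurcations (T : seq I) (Y : {set V}) : uniq T ->
  (forall t, t \in T -> trifurcates t Y) -> (size T <= #|Y|)%N.
Proof.
have [n] := ubnP (size T); elim: n T Y => // n IH T Y sT uT trT.
case: T sT uT trT => // t0 T0 sT uT trT.
have [u0 [_ [_ [ou0 _ _ _]]]] := trT t0 (mem_head _ _).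
pose good (d : nat) := has (fun t => [exists u, opens t Y u && (#|branch (G :\: b t) u| == d)]) (t0 :: T0).
have exg : exists d, good d.
  exists #|branch (G :\: b t0) u0|; apply/hasP; exists t0; first exact: mem_head.
  by apply/existsP; exists u0; rewrite ou0 eqxx.
case: (ex_minnP exg) => d /hasP[t tT /existsP[u /andP[ou /eqP ud]]] dmin.
have {}dmin t' u' : t' \in t0 :: T0 -> opens t' Y u' ->
    (#|branch (G :\: b t) u| <= #|branch (G :\: b t') u'|)%N.
  move=> t'T ou'; rewrite ud; apply: dmin; apply/hasP; exists t' => //.
  by apply/existsP; exists u'; rewrite ou' eqxx.
set B := branch (G :\: b t) u in dmin ud.
have [y yB yY] : exists2 y, y \in B & y \in Y.
  case/and3P: ou => _ _; rewrite disjoint_subset => /subsetPn[y yB].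
  by rewrite !inE negbK; exists y.
have uG : u \in G :\: b t by case/and3P: ou.
have size_rem : size (t0 :: T0) = (size (rem t (t0 :: T0))).+1.
  by rewrite size_rem.
rewrite size_rem; apply: (@leq_ltn_trans #|Y :\: B|); last first.
  apply: proper_card; apply/properP; split; first exact: subsetDl.
  by exists y; rewrite // inE yB.
apply: IH.
- by rewrite -ltnS -size_rem.
- exact: rem_uniq.
move=> t'; rewrite mem_rem_uniq // inE => /andP[t't t'T].
have keep u' : opens t' Y u' -> opens t' (Y :\: B) u'.
  move=> ou'; have /and3P[u'G /existsP[w /andP[wb wu']] nY] := ou'.
  apply/and3P; split=> //; first by apply/existsP; exists w; rewrite wb.
  set B' := branch (G :\: b t') u' in nY *.
  have B'G : B' \subset G :\: b t' by exact: branch_sub.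
  case: (boolP [disjoint B' & b t]) => [dis|].
    have B'Gt : B' \subset G :\: b t.
      rewrite finset.subsetD dis andbT; apply: fintype.subset_trans B'G _.
      exact: subsetDl.
    have dBB : [disjoint B' & B].
      apply/pred0P => z /=; apply/negbTE/negP => /andP[zB' zB].
      have B'B : B' \subset B.
        have := branch_avoid u'G B'Gt => /fintype.subset_trans; apply.
        have u'z : z \in branch (G :\: b t) u'.
          exact: (fintype.subsetP (branch_avoid u'G B'Gt)).
        by rewrite (branch_disj u'z zB).
      have wB : w \in B.
        apply: (@branch_step _ _ u'); rewrite 1?adj_sym //.
        - by apply: (fintype.subsetP B'B); exact: branch_refl.
        - by apply: (fintype.subsetP B'Gt); exact: branch_refl.
        - rewrite inE (fintype.subsetP (b_sub t')) // andbT.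
          by have /pred0P/(_ w) := b_disj t't; rewrite /= wb /= => ->.
      have : (#|B'| < #|B|)%N.
        apply: proper_card; apply/properP; split=> //; exists w => //.
        by apply/negP => /(fintype.subsetP B'G); rewrite inE wb.
      by rewrite ltnNge dmin.
    move: nY; rewrite !disjoint_subset => /subsetPn[z zB'].
    rewrite inE negbK => zY; apply/subsetPn; exists z => //.
    rewrite inE negbK inE zY andbT.
    by have /pred0P/(_ z) := dBB; rewrite /= zB' /= => ->.
  (* now B' contains the block t, hence a branch behind t other than B *)
  rewrite disjoint_subset => /subsetPn[z zB']; rewrite inE negbK => zt.
  have [v1 [v2 [v3 [op1 op2 op3 [n12 n23 n13]]]]] := trT t tT.
  have [v [ov vB vt']] : exists v, [/\ opens t Y v, branch (G :\: b t) v != B &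
      [disjoint branch (G :\: b t) v & b t']].
    (* b t' is connected in G minus b t, so it meets at most one branch *)
    have one v v' : opens t Y v -> opens t Y v' ->
        ~~ [disjoint branch (G :\: b t) v & b t'] ->
        ~~ [disjoint branch (G :\: b t) v' & b t'] ->
        branch (G :\: b t) v = branch (G :\: b t) v'.
      move=> _ _; rewrite !disjoint_subset => /subsetPn[x xv].
      rewrite inE negbK => xt' /subsetPn[x' x'v]; rewrite inE negbK => x't'.
      rewrite -(branch_eq xv) -(branch_eq x'v); apply/esym/branch_eq.
      apply: (fintype.subsetP (@branch_mono (b t') _ _ _)); last exact: b_conn.
      rewrite finset.subsetD b_sub /=; exact: b_disj.
    case: (eqVneq (branch (G :\: b t) v1) B) => [E1|N1].
      case: (boolP [disjoint branch (G :\: b t) v2 & b t']) => [|D2].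
        by exists v2; split; rewrite // -E1 eq_sym.
      exists v3; split; rewrite // -?E1 1?eq_sym //.
      by apply: contraNT n23 => D3; rewrite (one v2 v3).
    case: (boolP [disjoint branch (G :\: b t) v1 & b t']) => [|D1].
      by exists v1.
    case: (eqVneq (branch (G :\: b t) v2) B) => [E2|N2].
      exists v3; split; rewrite // -?E2 1?eq_sym //.
      by apply: contraNT n13 => D3; rewrite (one v1 v3).
    exists v2; split=> //.
    by apply: contraNT n12 => D2; rewrite (one v1 v2).
  have /and3P[vG /existsP[w' /andP[w't w'v]] nvY] := ov.
  have vGt' : branch (G :\: b t) v \subset G :\: b t'.
    rewrite finset.subsetD vt' andbT.
    exact: fintype.subset_trans (branch_sub vG) (subsetDl _ _).
  have bG : b t \subset G :\: b t'.
    by rewrite finset.subsetD b_sub /= b_disj // eq_sym.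
  have w'B' : w' \in B'.
    have zw' : w' \in branch (G :\: b t') z.
      apply: (fintype.subsetP (@branch_mono (b t) _ _ _)) => //; exact: b_conn.
    by rewrite /B' -(branch_eq zB').
  have vB' : v \in B'.
    apply: (@branch_step _ _ w') => //; first exact: (fintype.subsetP B'G).
    by apply: (fintype.subsetP vGt'); exact: branch_refl.
  have sub : branch (G :\: b t) v \subset B'.
    by rewrite /B' -(branch_eq vB'); exact: branch_avoid.
  move: nvY; rewrite !disjoint_subset => /subsetPn[x xv].
  rewrite inE negbK => xY; apply/subsetPn; exists x; first exact: (fintype.subsetP sub).
  rewrite inE negbK inE xY andbT; apply: contra vB => xB.
  by rewrite (branch_disj xv xB).
have [u1 [u2 [u3 [op1 op2 op3 neq]]]] := trT t' t'T.
by exists u1, u2, u3; split=> //; exact: keep.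
Qed.

End Count.
End Trifurcation.

Local Open Scope classical_set_scope.
Local Open Scope ring_scope.

(** * Finite-volume Gibbs expectations *)


Section GibbsFinite.
Context {R : realType} {N : nat}.
Variable beta : R.
Hypothesis beta0 : 0 <= beta.
Local Notation site := (vertex N).
Implicit Types (u v : config N) (s : bool) (f g : config N -> R) (B : {fset Z2}).

Definition edge_spin (e : {fset site}) u : R := \prod_(x <- e) spin R (u x).

Definition weight (E : seq {fset site}) u : R :=
  expR (beta * \sum_(e <- E) edge_spin e u).

Definition proper_edge (e : {fset site}) := exists x y : site, x != y /\ e = [fset x; y]%fset.

Lemma edge_spinE (x y : site) u : x != y ->
  edge_spin [fset x; y]%fset u = spin R (u x) * spin R (u y).
Proof.
by move=> xy; rewrite /edge_spin big_fsetU1 ?inE //= big_seq_fset1.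
Qed.

Lemma edge_spin_lattice e u v : proper_edge e ->
  edge_spin e u + edge_spin e v
    <= edge_spin e (cfg_or u v) + edge_spin e (cfg_and u v).
Proof.
move=> [x [y [xy ->]]]; rewrite !edge_spinE // /cfg_or /cfg_and /spin.
by case: (u x); case: (v x); case: (u y); case: (v y) => /=; lra.
Qed.

Lemma weight_gt0 E u : 0 < weight E u.
Proof. exact: expR_gt0. Qed.

Lemma weight_lattice E u v : (forall e, e \in E -> proper_edge e) ->
  weight E u * weight E v <= weight E (cfg_or u v) * weight E (cfg_and u v).
Proof.
move=> Ep; rewrite -!expRD ler_expR -!mulrDr ler_wpM2l // -!big_split /=.
by rewrite !big_seq; apply: ler_sum => e /Ep; exact: edge_spin_lattice.
Qed.

Lemma weight_cat E1 E2 u : weight (E1 ++ E2) u = weight E1 u * weight E2 u.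
Proof. by rewrite /weight big_cat mulrDr expRD. Qed.

Lemma weight_upd (E : seq {fset site}) u (x : site) b : (forall e, e \in E -> x \notin e) ->
  weight E (upd u x b) = weight E u.
Proof.
move=> xE; congr (expR (_ * _)); apply: eq_big_seq => e /xE xe.
apply: eq_big_seq => y ye; rewrite /upd; case: eqP => // yx.
by rewrite -yx ye in xe.
Qed.

Definition edges B : seq {fset site} := fset_set (@edges_meeting N B).

Lemma in_edges B e : (e \in edges B) = (e \in @edges_meeting N B).
Proof. by rewrite in_fset_set //; exact: finite_edges_meeting. Qed.

Lemma boltzmann_weight B u : boltzmann beta B u = weight (edges B) u.
Proof.
by rewrite /boltzmann /weight fsbig_finite //; exact: finite_edges_meeting.
Qed.

Lemma slab_adj_neq (x y : site) : slab_adj x y -> x != y.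
Proof.
by apply: contraTneq => ->; rewrite /slab_adj !subrr.
Qed.

Lemma edges_proper B e : e \in edges B -> proper_edge e.
Proof.
rewrite in_edges => /set_mem [x [y [-> xy _]]].
by exists x, y; split=> //; exact: slab_adj_neq.
Qed.

Definition sites B : seq site := [seq (c, k) | c <- enum_fset B, k <- enum 'I_N].

Lemma mem_sites B (x : site) : (x \in sites B) = (x.1 \in B).
Proof.
case: x => c k; apply/allpairsP/idP => /= [[[c' k'] /= [cB _ [-> _]]] //|cB].
by exists (c, k); split; rewrite ?mem_enum.
Qed.

Lemma sites_uniq B : uniq (sites B).
Proof.
rewrite allpairs_uniq ?enum_uniq ?fset_uniq //.
by move=> [? ?] [? ?] _ _ [-> ->].
Qed.

(** The spins inside a smaller volume interact with the rest only through the
    edges meeting that volume. *)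
Lemma weight_split B L : (B `<=` L)%fset -> exists E,
  perm_eq (edges L) (edges B ++ E) /\
  forall e x, e \in E -> x \in e -> x.1 \notin B.
Proof.
move=> BL; exists [seq e <- edges L | e \notin edges B].
split.
  have {1}-> : edges B = [seq e <- edges B | true] by rewrite filter_predT.
  apply: (@perm_trans _ ([seq e <- edges L | e \in edges B] ++ [seq e <- edges L | e \notin edges B])).
    by rewrite perm_sym perm_filterC.
  rewrite perm_cat2r filter_predT; apply: uniq_perm.
  - by rewrite filter_uniq // fset_uniq.
  - exact: fset_uniq.
  move=> e; rewrite mem_filter; case: (boolP (e \in edges B)) => //= eB.
  move: eB; rewrite !in_edges => /set_mem [x [y [-> xy h]]]; apply/mem_set.
  by exists x, y; split=> //; case/orP: h => /(fsubsetP BL) ->; rewrite ?orbT.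
move=> e z; rewrite mem_filter => /andP[eB eL] ze; apply: contra eB => zB.
move: eL; rewrite !in_edges => /set_mem [x [y [eE xy _]]]; apply/mem_set; exists x, y.
split=> //; move: ze; rewrite eE !inE => /orP[]/eqP zE; rewrite -zE zB ?orbT //.
Qed.

Definition gibbs B (s : bool) f : R :=
  isum (sites B) (fun u => weight (edges B) u * f u) (fun=> s)
    / isum (sites B) (weight (edges B)) (fun=> s).

Lemma Z_gt0 B u : 0 < isum (sites B) (weight (edges B)) u.
Proof. by apply: isum_gt0 => w; exact: weight_gt0. Qed.

Lemma gibbsD B s f g : gibbs B s (fun u => f u + g u) = gibbs B s f + gibbs B s g.
Proof.
rewrite /gibbs -mulrDl -isumD; congr (_ / _).
by apply: eq_isum => u; rewrite mulrDr.
Qed.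

Lemma gibbsZ B s c f : gibbs B s (fun u => c * f u) = c * gibbs B s f.
Proof.
rewrite /gibbs mulrA -isumZ; congr (_ / _).
by apply: eq_isum => u; rewrite mulrCA.
Qed.

Lemma gibbs1 B s : gibbs B s (fun=> 1) = 1.
Proof.
rewrite /gibbs (@eq_isum _ _ _ _ (weight (edges B))) => [|u]; last by rewrite mulr1.
by rewrite divff // gt_eqF // Z_gt0.
Qed.

Lemma gibbs_cst B s c : gibbs B s (fun=> c) = c.
Proof.
rewrite -[RHS]mulr1 -(gibbs1 B s) -gibbsZ; congr gibbs.
by apply/funext => u; rewrite mulr1.
Qed.

Lemma gibbs_sum B s (T : Type) (r : seq T) (F : T -> config N -> R) :
  gibbs B s (fun u => \sum_(i <- r) F i u) = \sum_(i <- r) gibbs B s (F i).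
Proof.
elim: r => [|i r IH].
  rewrite big_nil -[RHS](gibbs_cst B s); congr gibbs.
  by apply/funext => u; rewrite big_nil.
rewrite big_cons -IH -gibbsD; congr gibbs.
by apply/funext => u; rewrite big_cons.
Qed.

Lemma ler_gibbs B s f g : (forall u, f u <= g u) -> gibbs B s f <= gibbs B s g.
Proof.
move=> fg; rewrite ler_pM2r ?invr_gt0 ?Z_gt0 //.
by apply: ler_isum => u; rewrite ler_wpM2l // ltW // weight_gt0.
Qed.

Lemma gibbs_ge0 B s f : (forall u, 0 <= f u) -> 0 <= gibbs B s f.
Proof. by move=> f0; rewrite -(gibbs_cst B s 0); exact: ler_gibbs. Qed.

Definition cfg_incr f := forall u v, cfg_le u v -> f u <= f v.
Definition cfg_decr f := forall u v, cfg_le u v -> f v <= f u.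

(** Holley's inequality, with the boundary conditions left free. *)
Lemma isum_increasing B f u v : (forall w, 0 <= f w) -> cfg_incr f ->
  isum (sites B) (fun w => weight (edges B) w * f w) u
    * isum (sites B) (weight (edges B)) v <=
  isum (sites B) (fun w => weight (edges B) w * f w) (cfg_or u v)
    * isum (sites B) (weight (edges B)) (cfg_and u v).
Proof.
move=> f0 fi; apply: four_functions => [w|w|w|w|w w'].
- by rewrite mulr_ge0 // ltW // weight_gt0.
- by rewrite ltW // weight_gt0.
- by rewrite mulr_ge0 // ltW // weight_gt0.
- by rewrite ltW // weight_gt0.
rewrite mulrAC [leRHS]mulrAC; apply: ler_pM => //.
- by rewrite mulr_ge0 // ltW // weight_gt0.
- by apply: weight_lattice => e; exact: edges_proper.
- by apply: fi => x wx; rewrite /cfg_or wx.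
Qed.

Lemma gibbs_bc B f : (forall w, 0 <= f w) -> cfg_incr f ->
  gibbs B false f <= gibbs B true f.
Proof.
move=> f0 fi; rewrite ler_pdivrMr ?Z_gt0 // mulrAC ler_pdivlMr ?Z_gt0 //.
by have := isum_increasing B (fun=> false) (fun=> true) f0 fi.
Qed.

(** Positive association, for decreasing functions: on the meet of two
    configurations both functions are at least as large. *)
Lemma gibbs_fkg B s f g : (forall w, 0 <= f w) -> (forall w, 0 <= g w) ->
  cfg_decr f -> cfg_decr g ->
  gibbs B s f * gibbs B s g <= gibbs B s (fun u => f u * g u).
Proof.
move=> f0 g0 fd gd; rewrite mulf_div ler_pdivrMr ?mulr_gt0 ?Z_gt0 //.
rewrite mulrA divfK ?gt_eqF ?Z_gt0 // [leRHS]mulrC.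
have w0 u : 0 <= weight (edges B) u by rewrite ltW // weight_gt0.
have orr : cfg_or (fun=> s) (fun=> s) = (fun=> s) :> config N.
  by apply/funext => x; rewrite /cfg_or orbb.
have andd : cfg_and (fun=> s) (fun=> s) = (fun=> s) :> config N.
  by apply/funext => x; rewrite /cfg_and andbb.
rewrite -[X in _ <= isum _ _ X * _]orr -[X in _ <= _ * isum _ _ X]andd.
apply: four_functions => [u|u|u|u|u v] //; try by rewrite !mulr_ge0.
rewrite mulrACA [leRHS]mulrA; apply: ler_pM.
- by rewrite mulr_ge0.
- by rewrite mulr_ge0.
- by apply: weight_lattice => e; exact: edges_proper.
by apply: ler_pM => //; [apply: fd|apply: gd] => x /andP[].
Qed.



(** Spatial Markov property and monotonicity in the boundary condition: given
    the spins outside [B], the inside lies between the Gibbs states with minus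
    and with plus boundary. *)
Lemma gibbs_local B L s f D : (B `<=` L)%fset ->
  (forall u, 0 <= f u) -> cfg_incr f -> (forall u, 0 <= D u) ->
  (forall u x b, x.1 \in B -> D (upd u x b) = D u) ->
  gibbs B false f * gibbs L s D <= gibbs L s (fun u => f u * D u) /\
  gibbs L s (fun u => f u * D u) <= gibbs B true f * gibbs L s D.
Proof.
move=> BL f0 fi D0 Dout.
pose out := [seq x <- sites L | x.1 \notin B].
have pL : perm_eq (sites L) (out ++ sites B).
  rewrite -(perm_filterC (fun x : site => x.1 \notin B)) perm_cat2l.
  apply: uniq_perm; rewrite ?filter_uniq ?sites_uniq // => x.
  rewrite mem_filter /= negbK !mem_sites; case: (boolP (x.1 \in B)) => //=.
  by move=> /(fsubsetP BL).
have [E [pE Eout]] := @weight_split B L BL.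
have wL u : weight (edges L) u = weight (edges B) u * weight E u.
  by rewrite -weight_cat /weight (perm_big _ pE).
pose rest u := weight E u * D u.
have rest0 u : 0 <= rest u by rewrite mulr_ge0 // ltW // weight_gt0.
have restU u x b : x \in sites B -> rest (upd u x b) = rest u.
  rewrite mem_sites => xB; rewrite /rest Dout // weight_upd // => e eE.
  by apply: contraL xB; exact: Eout.
have num h : isum (sites L) (fun u => weight (edges L) u * (h u * D u)) (fun=> s) =
    isum out (fun t => isum (sites B) (fun u => weight (edges B) u * h u) t * rest t)
      (fun=> s).
  rewrite (isum_perm _ _ pL) isum_cat; apply: eq_isum => t.
  rewrite -isum_pull //; apply: eq_isum => u.
  by rewrite wL /rest; ring.
have num1 : isum (sites L) (fun u => weight (edges L) u * D u) (fun=> s) =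
    isum out (fun t => isum (sites B) (weight (edges B)) t * rest t) (fun=> s).
  rewrite -(@eq_isum _ _ _ (fun u => weight (edges L) u * (1 * D u))).
    rewrite num; apply: eq_isum => t; congr (_ * _).
    by apply: eq_isum => u; rewrite mulr1.
  by move=> u; rewrite mul1r.
have le_or t : cfg_or t (fun=> true) = (fun=> true) :> config N.
  by apply/funext => x; rewrite /cfg_or orbT.
have and_t t : cfg_and t (fun=> true) = t :> config N.
  by apply/funext => x; rewrite /cfg_and andbT.
have EL h : gibbs L s (fun u => h u * D u) = _ := congr1 (fun z => z / _) (num h).
have ED : gibbs L s D = _ := congr1 (fun z => z / _) num1.
rewrite EL ED !mulrA !ler_pM2r ?invr_gt0 ?Z_gt0 //.
split; rewrite -isumZ; apply: ler_isum => t; rewrite mulrA ler_wpM2r // mulrAC.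
  rewrite ler_pdivrMr ?Z_gt0 //.
  by have := isum_increasing B (fun=> false) t f0 fi.
rewrite ler_pdivlMr ?Z_gt0 //.
by have := isum_increasing B t (fun=> true) f0 fi; rewrite le_or and_t.
Qed.

Section Symmetry.
Variables (g g' : Z2 -> Z2) (B B' : {fset Z2}).
Hypotheses (gg' : cancel g g') (g'g : cancel g' g).
Hypothesis isometry : forall a b : Z2,
  ((g a).1 - (g b).1) ^+ 2 + ((g a).2 - (g b).2) ^+ 2
  = (a.1 - b.1) ^+ 2 + (a.2 - b.2) ^+ 2.
Hypothesis BB' : forall c, (g c \in B') = (c \in B).

Let G (x : site) : site := (g x.1, x.2).
Let G' (x : site) : site := (g' x.1, x.2).
Let GG' : cancel G G'. Proof. by move=> [c k]; rewrite /G /G' /= gg'. Qed.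
Let G'G : cancel G' G. Proof. by move=> [c k]; rewrite /G /G' /= g'g. Qed.

Definition move_cfg (u : config N) : config N := fun x => u (g' x.1, x.2).

Lemma sites_symmetry : perm_eq (sites B') (map G (sites B)).
Proof.
apply: uniq_perm; rewrite ?(map_inj_uniq (can_inj GG')) ?sites_uniq // => x.
rewrite -{2}(G'G x) (mem_map (can_inj GG')) !mem_sites /= -BB' /G' /=.
by rewrite g'g.
Qed.

Lemma edges_symmetry : perm_eq (edges B')
  (map (fun e : {fset site} => [fset G x | x in e]%fset) (edges B)).
Proof.
have adjG x y : slab_adj (G x) (G y) = slab_adj x y by rewrite /slab_adj /= isometry.
have im2 x y : [fset G z | z in [fset x; y]]%fset = [fset G x; G y]%fset.
  exact: imfset_fset2.
have inj : injective (fun e : {fset site} => [fset G x | x in e]%fset).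
  move=> e1 e2 /fsetP E; apply/fsetP => x; have := E (G x).
  by rewrite !mem_imfset //=; exact: can_inj GG'.
apply: uniq_perm; rewrite ?(map_inj_uniq inj) ?fset_uniq // => e.
apply/idP/mapP => [|[e0 + ->]]; rewrite !in_edges.
  move=> /set_mem [x [y [-> xy h]]]; exists [fset G' x; G' y]%fset.
    rewrite in_edges; apply/mem_set; exists (G' x), (G' y).
    by rewrite -adjG !G'G -!BB' /= !g'g.
  by rewrite im2 !G'G.
move=> /set_mem [x [y [-> xy h]]]; apply/mem_set; exists (G x), (G y).
by rewrite im2 adjG /= !BB'.
Qed.

Lemma weight_symmetry u : weight (edges B') (move_cfg u) = weight (edges B) u.
Proof.
congr (expR (_ * _)); rewrite (perm_big _ edges_symmetry) /= big_map.
apply: eq_bigr => e _; rewrite /edge_spin big_imfset /=.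
  by apply: eq_bigr => -[c k] _; rewrite /move_cfg /G /= gg'.
by move=> x y _ _; exact: can_inj GG' _ _.
Qed.

Lemma gibbs_symmetry s f : gibbs B' s f = gibbs B s (f \o move_cfg).
Proof.
rewrite /gibbs !(isum_perm _ _ sites_symmetry) !(isum_map _ _ _ GG' G'G).
by congr (_ / _); apply: eq_isum => u /=; rewrite -weight_symmetry.
Qed.

End Symmetry.

Definition flip_cfg (u : config N) : config N := fun x => ~~ u x.

Lemma flip_cfgK : involutive flip_cfg.
Proof. by move=> u; apply/funext => x; rewrite /flip_cfg negbK. Qed.

Lemma weight_flip E u : (forall e, e \in E -> proper_edge e) ->
  weight E (flip_cfg u) = weight E u.
Proof.
move=> Ep; congr (expR (_ * _)); apply: eq_big_seq => e /Ep[x [y [xy ->]]].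
by rewrite !edge_spinE // /flip_cfg /spin; case: (u x); case: (u y) => /=; ring.
Qed.

Lemma gibbs_flip B s f : gibbs B s f = gibbs B (~~ s) (f \o flip_cfg).
Proof.
rewrite /gibbs -{1 2}(negbK s) !(isum_flip _ _ (fun=> ~~ s)).
by congr (_ / _); apply: eq_isum => u /=; rewrite weight_flip // => e;
  exact: edges_proper.
Qed.

End GibbsFinite.

(** * The Ising measure as an iterated sum *)

Section FiniteVolumeLink.
Context {R : realType} {N : nat}.
Variables (beta : R) (B : {fset Z2}) (s : bool).

Lemma glue_in (eta : {ffun B * 'I_N -> bool}) (x : vertex N) (xB : x.1 \in B) :
  Defs.glue s eta x = eta ([` xB]%fset, x.2).
Proof. by rewrite /Defs.glue insubT. Qed.

Lemma glue_out (eta : {ffun B * 'I_N -> bool}) (x : vertex N) :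
  x.1 \notin B -> Defs.glue s eta x = s.
Proof. by move=> xB; rewrite /Defs.glue insubF //; exact/negbTE. Qed.

(** Summing out one spin doubles the total sum over configurations, as flipping
    that spin is an involution; after all spins are summed out the summand is
    constant. *)
Lemma sum_glue (F : config N -> R) :
  \sum_(eta : {ffun B * 'I_N -> bool}) F (Defs.glue s eta) = isum (sites B) F (fun=> s).
Proof.
have step (H : config N -> R) x : x.1 \in B ->
    \sum_(eta : {ffun B * 'I_N -> bool})
      (H (upd (Defs.glue s eta) x true) + H (upd (Defs.glue s eta) x false)) =
    2 * \sum_(eta : {ffun B * 'I_N -> bool}) H (Defs.glue s eta).
  move=> xB; pose j : B * 'I_N := ([` xB]%fset, x.2).
  pose fl (eta : {ffun B * 'I_N -> bool}) : {ffun B * 'I_N -> bool} :=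
    [ffun i => if i == j then ~~ eta i else eta i].
  have flK : involutive fl.
    by move=> eta; apply/ffunP => i; rewrite !ffunE; case: eqP => // _; rewrite negbK.
  have glue_fl eta : Defs.glue s (fl eta) = upd (Defs.glue s eta) x (~~ Defs.glue s eta x).
    apply/funext => y; rewrite /upd; case: eqP => [->|yx].
      by rewrite !glue_in ffunE eqxx.
    case: (boolP (y.1 \in B)) => yB; last by rewrite !glue_out.
    rewrite !glue_in ffunE; case: eqP => // -[E1 E2]; case: yx.
    by rewrite [LHS]surjective_pairing E1 E2 -surjective_pairing.
  rewrite mulr_natl mulr2n [X in _ = _ + X](reindex_inj (inv_inj flK)) /= -big_split /=.
  apply: eq_bigr => eta _; rewrite glue_fl.
  by case E: (Defs.glue s eta x); rewrite -{1}E upd_same // addrC.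
have iter (l : seq (vertex N)) : (forall x, x \in l -> x.1 \in B) ->
    \sum_(eta : {ffun B * 'I_N -> bool}) isum l F (Defs.glue s eta) =
    2 ^+ size l * \sum_(eta : {ffun B * 'I_N -> bool}) F (Defs.glue s eta).
  elim: l => [|x l IH] lB; first by rewrite expr0 mul1r.
  rewrite /= (step (isum l F)) ?lB ?mem_head // IH ?exprS ?mulrA //.
  by move=> y yl; rewrite lB // inE yl orbT.
have two0 n : (2 : R) ^+ n != 0 by rewrite expf_neq0.
apply: (mulfI (two0 (size (sites B)))); apply: etrans (esym (iter _ _)) _.
  by move=> x; rewrite mem_sites.
under eq_bigr => eta _.
  rewrite (@isum_agree _ _ _ _ _ (fun=> s)); last first.
    by move=> x; rewrite mem_sites; exact: glue_out.
  over.
rewrite sumr_const card_ffun card_bool card_prod -cardfE card_ord.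
by rewrite -[LHS]mulr_natl natrX size_allpairs -cardE card_ord.
Qed.

Lemma ising_gibbs (A : set (config_space N)) :
  ising beta B s A = (gibbs beta B s (\1_A : config N -> R))%:E.
Proof.
rewrite /ising /gibbs /partition_function.
under eq_bigr do rewrite diracE -EFinM.
rewrite sumEFin; congr EFin.
rewrite -(sum_glue (weight beta (edges B))) -(sum_glue (fun u => _ * _)) mulr_suml.
have -> : \sum_(eta : {ffun B * 'I_N -> bool}) boltzmann beta B (Defs.glue s eta)
    = \sum_(eta : {ffun B * 'I_N -> bool}) weight beta (edges B) (Defs.glue s eta).
  by apply: eq_bigr => eta _; exact: boltzmann_weight.
by apply: eq_bigr => eta _; rewrite boltzmann_weight mulrAC.
Qed.

End FiniteVolumeLink.

(** * Comparing the magnetizations of neighbouring sites *)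

Section NeighborGap.
Context {R : realType} {N : nat}.
Variable beta : R.
Hypothesis beta0 : 0 < beta.
Local Notation site := (vertex N).

Definition plus_at (x : site) (u : config N) : R := (u x)%:R.

Definition gap B (x : site) : R :=
  gibbs beta B true (plus_at x) - gibbs beta B false (plus_at x).

Section Column.
Variables x y : site.
Hypothesis xy : slab_adj x y.

Let E0 := @edges N [fset x.1]%fset.
Let W0 := weight beta E0.

(** Conditional probability of a plus spin at [x] given all other spins. *)
Let psi (u : config N) : R :=
  W0 (upd u x true) / (W0 (upd u x true) + W0 (upd u x false)).

Let W0_gt0 u : 0 < W0 u. Proof. exact: weight_gt0. Qed.

(** Pair the configurations that differ only at [x]: both sides give each pair the
    same total. *)
Lemma gibbs_psi B s : x.1 \in B -> gibbs beta B s (plus_at x) = gibbs beta B s psi.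
Proof.
move=> xB; rewrite /gibbs; congr (_ / _).
have xS : x \in sites B by rewrite mem_sites.
have pS : perm_eq (sites B) (rcons (rem x (sites B)) x).
  by rewrite perm_sym perm_rcons perm_sym perm_to_rem.
rewrite !(isum_perm _ _ pS) -cats1 !isum_cat; apply: eq_isum => u /=.
have [E [pE Eout]] : exists E, perm_eq (edges B) (E0 ++ E) /\
    forall e z, e \in E -> z \in e -> z.1 \notin [fset x.1]%fset.
  by apply: weight_split; rewrite fsub1set.
have wB v : weight beta (edges B) v = W0 v * weight beta E v.
  by rewrite -weight_cat /weight (perm_big _ pE).
have wE b : weight beta E (upd u x b) = weight beta E u.
  apply: weight_upd => e eE; apply/negP => /(Eout e _ eE).
  by rewrite inE eqxx.
have psi_upd b : psi (upd u x b) = psi u by rewrite /psi !upd_twice.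
rewrite !psi_upd !wB !wE /plus_at /upd eqxx mulr1 mulr0 addr0 -/upd.
have := W0_gt0 (upd u x true); have := W0_gt0 (upd u x false).
rewrite /psi; move: (W0 _) (W0 _) (weight _ _ _) => a b c a0 b0.
by field; lra.
Qed.

Lemma weight_bound : exists2 K : R, 0 < K & forall u, K^-1 <= W0 u <= K.
Proof.
exists (expR (beta * (size E0)%:R)); first exact: expR_gt0.
move=> u; rewrite -expRN !ler_expR -mulrN !ler_pM2l // -ler_norml.
have : forall e, e \in E0 -> proper_edge e by exact: edges_proper.
elim: (E0) => [|e E IH] Ep; first by rewrite big_nil normr0.
rewrite big_cons /= -natr1; apply: le_trans (ler_normD _ _) _.
rewrite [leRHS]addrC lerD ?IH // => [|e' e'E]; last by apply: Ep; rewrite inE e'E orbT.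
have [a [b [ab ->]]] := Ep e (mem_head _ _).
by rewrite edge_spinE // normrM /spin; case: (u a); case: (u b);
  rewrite ?normrN ?normr1 mulr1.
Qed.

(** For [u <= v] with spin -1 at [y] in [u] and +1 in [v], the edge between [x]
    and [y] improves the lattice inequality by the factor [expR (- (4 * beta))]. *)
Lemma weight_gap u v : cfg_le u v ->
  W0 (upd v x false) * W0 (upd u x true) <=
  (if ~~ u y && v y then expR (- (4 * beta)) else 1) *
    (W0 (upd v x true) * W0 (upd u x false)).
Proof.
move=> uv; have xny := slab_adj_neq xy; have ynx : y != x by rewrite eq_sym.
have eE0 : [fset x; y]%fset \in E0.
  rewrite in_edges; apply/mem_set; exists x, y; split=> //.
  by rewrite inE eqxx.
pose E1 := rem [fset x; y]%fset E0.
have wE w : W0 w = expR (beta * (spin R (w x) * spin R (w y))) * weight beta E1 w.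
  rewrite /W0 /weight (perm_big _ (perm_to_rem eE0)) big_cons mulrDr expRD.
  by rewrite edge_spinE.
have := @weight_lattice _ _ _ (ltW beta0) E1 (upd v x false) (upd u x true).
rewrite upd_or upd_and /=.
have -> : cfg_or v u = v.
  by rewrite -[RHS](cfg_le_or uv); apply/funext => z; rewrite /cfg_or orbC.
have -> : cfg_and v u = u.
  by rewrite -[RHS](cfg_le_and uv); apply/funext => z; rewrite /cfg_and andbC.
move=> H; have {}H := H (fun e eE => @edges_proper _ _ e (mem_rem eE)).
have updx w b : upd w x b x = b by rewrite /upd eqxx.
have updy w b : upd w x b y = w y by rewrite /upd (negbTE ynx).
rewrite !wE !updx !updy.
have exchange (p q r t X A B C D : R) : p * q = X * (r * t) -> A * B <= C * D ->
    0 <= p * q -> (p * A) * (q * B) <= X * ((r * C) * (t * D)).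
  move=> pq AB pq0; rewrite [r * C * _]mulrACA [leLHS]mulrACA [leRHS]mulrA -pq.
  exact: ler_wpM2l.
have uy : u y -> v y by exact: uv.
have pq0 (a b : R) : 0 <= expR a * expR b by rewrite mulr_ge0 // expR_ge0.
apply: exchange; [|exact: H|exact: pq0].
rewrite -!expRD /spin; case E : (~~ u y && v y).
  by move: E => /andP[/negbTE -> ->]; rewrite -expRD; congr expR; ring.
rewrite mul1r; congr expR.
by move: E uy; case: (u y); case: (v y) => //= _ uy; [ring|have := uy isT|ring].
Qed.

Lemma psi_gap : exists2 c : R, 0 < c & forall u v, cfg_le u v ->
  c * (plus_at y v - plus_at y u) <= psi v - psi u.
Proof.
(* the numerator of psi v - psi u is bounded below by weight_gap, and its
   denominator is at most (2 K) ^ 2 *)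
have [K K0 WK] := weight_bound.
pose q : R := expR (- (4 * beta)).
have q1 : q < 1 by rewrite /q -[ltRHS]expR0 ltr_expR; move: beta0; lra.
have Kn w : W0 w <= K by have /andP[] := WK w.
have Kl w : K^-1 <= W0 w by have /andP[] := WK w.
exists ((1 - q) * (K^-1 * K^-1) / ((K + K) * (K + K))).
  by rewrite divr_gt0 ?mulr_gt0 ?invr_gt0 ?subr_gt0 ?addr_gt0.
move=> u v uv; have := weight_gap uv; rewrite /psi /plus_at -/q.
move: (Kn (upd u x true)) (Kn (upd u x false)) (Kn (upd v x true)) (Kn (upd v x false)).
move: (Kl (upd u x false)) (Kl (upd v x true)).
move: (W0_gt0 (upd u x true)) (W0_gt0 (upd u x false)).
move: (W0_gt0 (upd v x true)) (W0_gt0 (upd v x false)).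
move: (W0 (upd u x true)) (W0 (upd u x false)) (W0 (upd v x true)) (W0 (upd v x false)).
move=> a b a' b' a'0 b'0 a0 b0 lb la' ka kb ka' kb' h.
have -> : a' / (a' + b') - a / (a + b) = (a' * b - b' * a) / ((a' + b') * (a + b)).
  by field; rewrite !gt_eqF ?addr_gt0.
have den0 : 0 < (a' + b') * (a + b) by rewrite mulr_gt0 ?addr_gt0.
have den : (a' + b') * (a + b) <= (K + K) * (K + K).
  by apply: ler_pM; [exact: addr_ge0 (ltW _) (ltW _)|exact: addr_ge0 (ltW _) (ltW _)|exact: lerD|exact: lerD].
have uvy : u y -> v y by exact: uv.
case: (boolP (~~ u y && v y)) h => [/andP[/negbTE -> ->]|nuv] h.
  rewrite subr0 mulr1.
  have num : (1 - q) * (K^-1 * K^-1) <= a' * b - b' * a.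
    apply: (@le_trans _ _ ((1 - q) * (a' * b))); last by rewrite mulrBl mul1r; lra.
    apply: ler_wpM2l; first by rewrite subr_ge0 ltW.
    by apply: ler_pM => //; rewrite invr_ge0 ltW.
  apply: ler_pM => //.
  - by rewrite !mulr_ge0 ?invr_ge0 ?subr_ge0 ?ltW.
  - by rewrite invr_ge0 ltW ?mulr_gt0 ?addr_gt0.
  by rewrite lef_pV2 ?posrE ?mulr_gt0 ?addr_gt0.
have -> : (v y)%:R - (u y)%:R = 0 :> R.
  by move: nuv uvy; case: (u y); case: (v y) => //= _ H; rewrite ?subrr //; have := H isT.
by rewrite mulr0 divr_ge0 // ?(ltW den0) // subr_ge0; move: h; rewrite mul1r.
Qed.

(** The spin at [x] has conditional plus probability [psi], which grows at least
    at a fixed rate with the spin at [y]; so if the two boundary conditions are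
    far apart at [y], they are apart at [x]. *)
Lemma gap_neighbor : exists2 c : R, 0 < c &
  forall B, x.1 \in B -> c * gap B y <= gap B x.
Proof.
have [c c0 cP] := psi_gap; exists c => // B xB.
pose f u := psi u + (c - c * plus_at y u).
have psi0 u : 0 <= psi u by rewrite divr_ge0 ?addr_ge0 // ltW.
have f0 u : 0 <= f u.
  rewrite addr_ge0 // subr_ge0 -[leRHS]mulr1 ler_wpM2l ?(ltW c0) // /plus_at.
  by case: (u y).
have fi : cfg_incr f.
  by move=> u v uv; have := cP u v uv; rewrite /f mulrBr; lra.
have := gibbs_bc (ltW beta0) B f0 fi.
have fE s : gibbs beta B s f = gibbs beta B s (plus_at x) + (c - c * gibbs beta B s (plus_at y)).
  rewrite gibbs_psi // -[X in _ + (X - _)](@gibbs_cst _ N beta B s c) -mulNr.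
  by rewrite -gibbsZ -!gibbsD; congr gibbs; apply/funext => u; rewrite /f mulNr.
by rewrite !fE /gap mulrBr; lra.
Qed.

End Column.
End NeighborGap.

(** * Infinite-volume limits on cylinder events *)

Section Cylinders.
Context {N : nat}.
Implicit Types (A D : set (config N)).

Lemma cylinderC A : cylinder A -> cylinder (~` A).
Proof.
move=> [F AF]; exists F => u v uv nA /AF; apply: contra_not nA; apply => x xF.
by rewrite uv.
Qed.

Lemma cylinderI A D : cylinder A -> cylinder D -> cylinder (A `&` D).
Proof.
move=> [F AF] [F' DF]; exists (F `|` F')%fset => u v uv [uA uD]; split.
  by apply: AF uA => x xF; rewrite uv // inE xF.
by apply: DF uD => x xF; rewrite uv // inE xF orbT.
Qed.

Lemma cylinder_measurable A : cylinder A -> measurable (A : set (config_space N)).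
Proof. by move=> cA; exact: sub_sigma_algebra. Qed.

Lemma cylinder_continuous {R : realType} A : cylinder A ->
  continuous (\1_A : {ptws vertex N -> bool} -> R).
Proof.
move=> [F AF] u; apply: cvg_near_cst.
have FF : Filter (nbhs (u : {ptws vertex N -> bool})) := nbhs_filter _.
have near_eq (x : vertex N) : \forall v \near (u : {ptws vertex N -> bool}), v x = u x.
  have := @proj_continuous (vertex N) (fun=> bool) x u.
  move=> /(_ [set u x]); apply; exact: discrete_set1.
have near_all (l : seq (vertex N)) :
    nbhs (u : {ptws vertex N -> bool}) [set v | forall x, x \in l -> v x = u x].
  elim: l => [|x l IH].
    rewrite (_ : [set v | _] = setT); first exact: filterT.
    by apply/seteqP; split.
  apply: (@filterS _ _ FF _ _ _ (@filterI _ _ FF _ _ (near_eq x) IH)).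
  by move=> v [vx vl] y /=; rewrite inE => /orP[/eqP -> //|]; exact: vl.
apply: (@filterS _ _ FF _ _ _ (near_all (enum_fset F))) => v vu.
rewrite !indicE; congr (_%:R); congr nat_of_bool.
apply/idP/idP => /set_mem H; apply/mem_set; apply: AF H => x xF.
  by rewrite vu.
by rewrite vu.
Qed.

End Cylinders.

Section Limit.
Context {R : realType} {N : nat}.
Variable beta : R.

(** All that the argument uses of the infinite-volume state: the probabilities of
    cylinder events are limits along every growing sequence of boxes.  Taking
    [m] to be a mere set function lets one handle the plus state and its
    image under the spin flip together. *)
Definition infinite_volume (s : bool) (m : set (config N) -> R) : Prop :=
  forall B_, boxes_increase_to_Z2 B_ -> forall A, cylinder A ->
    (fun n => gibbs beta (B_ n) s (\1_A)) @ \oo --> m A.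

Lemma ising_state_limit s (mu : probability (config_space N) R) :
  is_ising_state beta s mu -> infinite_volume s (fun A => fine (mu A)).
Proof.
move=> mus B_ BZ A cA.
have mA := cylinder_measurable cA.
have := mus B_ BZ (\1_A : config_space N -> R) (cylinder_continuous cA).
have bA : [bounded (\1_A : config_space N -> R) u | u in [set: config_space N]].
  exists 1; split; rewrite ?num_real // => M M1 u _ /=.
  by rewrite indicE; apply: le_trans (ltW M1); case: (_ \in _); rewrite ?normr1 ?normr0.
move=> /(_ bA).
have E n : ('E_(ising beta (B_ n) s)[\1_A : config_space N -> R])%E
    = (gibbs beta (B_ n) s \1_A)%:E.
  by rewrite expectation_indic //; exact: ising_gibbs.
under eq_fun do rewrite E.
rewrite expectation_indic //.
rewrite -[X in _ --> X]fineK ?fin_num_measure //.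
by move=> /fine_cvgP[_].
Qed.

End Limit.

Definition cbox (c : Z2) (n : nat) : {fset Z2} :=
  [fset ((c.1 - n%:Z + i%:Z)%R, (c.2 - n%:Z + j%:Z)%R) |
    i in iota 0 n.*2.+1, j in iota 0 n.*2.+1]%fset.

Lemma in_cbox c n v : (v \in cbox c n) = ball n%:Z (v.1 - c.1, v.2 - c.2).
Proof.
apply/imfset2P/idP => /= [[i hi [j hj ->]]|].
  have : (i < n.*2.+1)%N by move: hi; rewrite inE mem_iota; lia.
  have : (j < n.*2.+1)%N by move: hj; rewrite inE mem_iota; lia.
  by rewrite /ball /=; lia.
case: v => a b; rewrite /ball /= => H.
exists (absz (a - c.1 + n%:Z)%R); first by rewrite inE mem_iota; lia.
exists (absz (b - c.2 + n%:Z)%R); first by rewrite inE mem_iota; lia.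
by congr (_, _); lia.
Qed.

Lemma cbox_increase c : boxes_increase_to_Z2 (cbox c).
Proof.
split=> [n|n|v].
- exists (c.1 - n%:Z), (c.1 + n%:Z), (c.2 - n%:Z), (c.2 + n%:Z) => v.
  by rewrite in_cbox /ball /=; lia.
- by apply/fsubsetP => v; rewrite !in_cbox /ball /=; lia.
exists (absz (v.1 - c.1)%R + absz (v.2 - c.2)%R)%N; rewrite in_cbox /ball /=; lia.
Qed.

Section State.
Context {R : realType} {N : nat}.
Variable beta : R.
Hypothesis beta0 : 0 <= beta.
Implicit Types (A D : set (config N)).

Definition incr_event A := forall u v, cfg_le u v -> A u -> A v.
Definition decr_event A := forall u v, cfg_le u v -> A v -> A u.

Lemma indic_incr A : incr_event A -> cfg_incr (\1_A : config N -> R).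
Proof.
move=> iA u v uv; rewrite !indicE; case: (boolP (u \in A)) => [/set_mem uA|_].
  by rewrite (mem_set (iA _ _ uv uA)).
by rewrite ler0n.
Qed.

Lemma indic_decr A : decr_event A -> cfg_decr (\1_A : config N -> R).
Proof.
move=> iA u v uv; rewrite !indicE; case: (boolP (v \in A)) => [/set_mem uA|_].
  by rewrite (mem_set (iA _ _ uv uA)).
by rewrite ler0n.
Qed.

Lemma indic_ge0 A u : 0 <= (\1_A u : R).
Proof. by rewrite indicE ler0n. Qed.

Lemma indic_setI A D u : \1_(A `&` D) u = \1_A u * \1_D u :> R.
Proof. by rewrite indicI. Qed.

Lemma indic_mono A D u : A `<=` D -> \1_A u <= \1_D u :> R.
Proof.
move=> AD; rewrite !indicE; case: (boolP (u \in A)) => [/set_mem uA|_].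
  by rewrite (mem_set (AD _ uA)).
by rewrite ler0n.
Qed.

Lemma indic_setC A u : \1_(~` A) u = 1 - \1_A u :> R.
Proof.
rewrite !indicE; case: (boolP (u \in A)) => [/set_mem uA|/negP uA].
  by rewrite memNset ?subrr //; apply.
by rewrite mem_set ?subr0 // => uA'; apply: uA; exact: mem_set.
Qed.

Variable m : set (config N) -> R.
Hypothesis hm : infinite_volume beta true m.

Local Notation vol n := (cbox Z2_origin n).

Lemma vol_cvg A : cylinder A -> (fun n => gibbs beta (vol n) true (\1_A)) @ \oo --> m A.
Proof. by move=> cA; apply: hm => //; exact: cbox_increase. Qed.

(** Monotonicity, the union bound and the count of trifurcation blocks pass to
    infinite volume in this form. *)
Lemma prob_lin (T : eqType) (r : seq T) (c : T -> R) (E : T -> set (config N)) (C : R) :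
  (forall i, i \in r -> cylinder (E i)) ->
  (forall u, \sum_(i <- r) c i * \1_(E i) u <= C) ->
  \sum_(i <- r) c i * m (E i) <= C.
Proof.
move=> cE H.
have cv : (fun n => \sum_(i <- r) c i * gibbs beta (vol n) true (\1_(E i))) @ \oo
    --> \sum_(i <- r) c i * m (E i).
  elim: r cE {H} => [|i r IH] cE.
    under eq_fun do rewrite big_nil.
    by rewrite big_nil; exact: cvg_cst.
  under eq_fun do rewrite big_cons.
  rewrite big_cons; apply: cvgD; last by apply: IH => j jr; apply: cE; rewrite inE jr orbT.
  by apply: cvgMl_tmp; apply: vol_cvg; apply: cE; exact: mem_head.
apply: (cvgr_to_le cv); apply: nearW => n.
rewrite (eq_bigr (fun i => gibbs beta (vol n) true (fun u => c i * \1_(E i) u))).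
  by rewrite -gibbs_sum -[leRHS](@gibbs_cst _ N beta (vol n) true); exact: ler_gibbs.
by move=> i _; rewrite gibbsZ.
Qed.

Lemma prob_le A D : cylinder A -> cylinder D -> A `<=` D -> m A <= m D.
Proof.
move=> cA cD AD; rewrite -subr_le0.
have := @prob_lin bool [:: true; false] (fun b => if b then 1 else -1)
  (fun b => if b then A else D) 0.
rewrite !big_cons big_nil addr0 mul1r mulN1r; apply.
  by case.
move=> u; rewrite !big_cons big_nil addr0 mul1r mulN1r subr_le0.
exact: indic_mono.
Qed.

Lemma prob_ge0 A : cylinder A -> 0 <= m A.
Proof.
move=> cA; apply: (cvgr_to_ge (vol_cvg cA)); apply: nearW => n.
by apply: gibbs_ge0 => u; exact: indic_ge0.
Qed.

Lemma prob_setC A : cylinder A -> m (~` A) = 1 - m A.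
Proof.
move=> cA; have cv := vol_cvg (cylinderC cA).
apply: (@cvg_unique _ (@Rhausdorff R) _ _ _ _ cv).
have -> : (fun n => gibbs beta (vol n) true (\1_(~` A))) =
    (fun n => 1 - gibbs beta (vol n) true (\1_A)).
  apply/funext => n; rewrite -{1}(@gibbs1 _ N beta (vol n) true) -mulN1r -gibbsZ -gibbsD.
  by congr gibbs; apply/funext => u; rewrite indic_setC mulN1r.
by apply: cvgB; [exact: cvg_cst|exact: vol_cvg].
Qed.

Lemma prob_le1 A : cylinder A -> m A <= 1.
Proof.
by move=> cA; have := prob_ge0 (cylinderC cA); rewrite prob_setC // subr_ge0.
Qed.

Lemma prob_fkg A D : cylinder A -> cylinder D -> decr_event A -> decr_event D ->
  m A * m D <= m (A `&` D).
Proof.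
move=> cA cD dA dD.
apply: (ler_cvg_to (cvgM (vol_cvg cA) (vol_cvg cD)) (vol_cvg (cylinderI cA cD))).
apply: nearW => n /=.
have -> : \1_(A `&` D) = (fun u => \1_A u * \1_D u) :> (config N -> R).
  by apply/funext => u; exact: indic_setI.
by apply: gibbs_fkg; rewrite // => *; rewrite ?indic_ge0 //; exact: indic_decr.
Qed.

Lemma prob_local (B : {fset Z2}) A D : cylinder A -> cylinder D -> incr_event A ->
  (forall u (x : vertex N) b, x.1 \in B -> D u -> D (upd u x b)) ->
  gibbs beta B false (\1_A) * m D <= m (A `&` D) /\
  m (A `&` D) <= gibbs beta B true (\1_A) * m D.
Proof.
move=> cA cD iA DB.
have Dout u (x : vertex N) b : x.1 \in B -> \1_D (upd u x b) = \1_D u :> R.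
  move=> xB; rewrite !indicE; congr (_%:R); congr nat_of_bool.
  apply/idP/idP => /set_mem H; apply/mem_set; last exact: DB.
  by have := DB _ x (u x) xB H; rewrite upd_twice upd_same.
have inI : \1_(A `&` D) = (fun u => \1_A u * \1_D u) :> (config N -> R).
  by apply/funext => u; exact: indic_setI.
have BL : \forall n \near \oo, (B `<=` vol n)%fset.
  have [_ mono cov] := cbox_increase Z2_origin.
  have up (p q : nat) : (p <= q)%N -> (vol p `<=` vol q)%fset.
    elim: q => [|q IH]; first by rewrite leqn0 => /eqP ->.
    rewrite leq_eqVlt => /orP[/eqP -> //|/IH h]; exact: fsubset_trans h (mono q).
  have [n0 H] : exists n0, forall x, x \in enum_fset B -> x \in vol n0.
    elim: (enum_fset B) => [|x l [n0 IH]]; first by exists 0%N.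
    have [n1 xn1] := cov x; exists (maxn n0 n1) => y; rewrite inE => /orP[/eqP ->|yl].
      by apply: (fsubsetP (up _ _ (leq_maxr n0 n1))).
    by apply: (fsubsetP (up _ _ (leq_maxl n0 n1))); exact: IH.
  exists n0 => // n /= n0n; apply/fsubsetP => x xB.
  by apply: (fsubsetP (up _ _ n0n)); exact: H.
have cvD (c : R) : (fun n => c * gibbs beta (vol n) true (\1_D)) @ \oo --> c * m D.
  by apply: cvgMl_tmp; exact: vol_cvg.
have loc n (BLn : (B `<=` vol n)%fset) := gibbs_local beta0 true BLn (indic_ge0 A)
  (indic_incr iA) (indic_ge0 D) Dout.
have cI := vol_cvg (cylinderI cA cD); rewrite inI in cI.
split.
  apply: (ler_cvg_to (cvD _) cI); apply: filterS BL => n /loc[h _]; exact: h.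
apply: (ler_cvg_to cI (cvD _)); apply: filterS BL => n /loc[_ h]; exact: h.
Qed.

Lemma cylinder_move (g : Z2 -> Z2) A : cylinder A -> cylinder (@move_cfg N g @^-1` A).
Proof.
move=> [F AF]; exists [fset (g x.1, x.2) | x in F]%fset => u v uv /=; apply: AF.
by move=> x xF; apply: uv; apply/imfsetP; exists x.
Qed.

(** The limit is the same along all growing sequences of boxes, so it does not
    change when the boxes are moved by an isometry. *)
Lemma prob_symmetry (g g' : Z2 -> Z2) A : cancel g g' -> cancel g' g ->
  (forall a b : Z2, ((g a).1 - (g b).1) ^+ 2 + ((g a).2 - (g b).2) ^+ 2
     = (a.1 - b.1) ^+ 2 + (a.2 - b.2) ^+ 2) ->
  (forall n v, (g v \in cbox (g Z2_origin) n) = (v \in vol n)) ->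
  cylinder A -> m (@move_cfg N g' @^-1` A) = m A.
Proof.
move=> gg' g'g iso gbox cA.
have cv := vol_cvg (cylinder_move g' cA).
apply: (@cvg_unique _ (@Rhausdorff R) _ _ _ _ cv).
have h := hm (cbox_increase (g Z2_origin)) cA.
suff E n : gibbs beta (cbox (g Z2_origin) n) true (\1_A)
    = gibbs beta (vol n) true (\1_(@move_cfg N g' @^-1` A)).
  exact: (eq_ind _ (fun f : nat -> R => f @ \oo --> m A) h _ (funext E)).
rewrite (gibbs_symmetry beta gg' g'g iso (gbox n)).
by congr gibbs; apply/funext => u.
Qed.

Lemma cylinder_flip A : cylinder A -> cylinder (@flip_cfg N @^-1` A).
Proof.
move=> [F AF]; exists F => u v uv /=; apply: AF.
by move=> x xF; rewrite /flip_cfg uv.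
Qed.

Lemma flip_limit : infinite_volume beta false (fun A => m (@flip_cfg N @^-1` A)).
Proof.
move=> B_ BZ A cA.
have := hm BZ (cylinder_flip cA).
suff E n : gibbs beta (B_ n) true (\1_(@flip_cfg N @^-1` A))
    = gibbs beta (B_ n) false (\1_A) by under eq_fun do rewrite E.
rewrite (gibbs_flip _ _ false).
by congr gibbs; apply/funext => u.
Qed.


Definition plus_set (x : vertex N) : set (config N) := [set u | u x].

Lemma plus_set_cylinder x : cylinder (plus_set x).
Proof.
exists [fset x]%fset => u v uv; rewrite /plus_set /= => ux.
by rewrite -uv // inE.
Qed.

Lemma plus_atE x : plus_at x = \1_(plus_set x) :> (config N -> R).
Proof.
apply/funext => u; rewrite /plus_at indicE; congr (_%:R); congr nat_of_bool.
by apply/idP/idP => [ux|/set_mem //]; apply/mem_set.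
Qed.

Lemma plus_at_incr x : cfg_incr (plus_at x : config N -> R).
Proof.
by move=> u v uv; rewrite /plus_at ler_nat; move: (uv x); case: (u x) => // ->.
Qed.

Lemma plus_at_ge0 (x : vertex N) u : 0 <= (plus_at x u : R).
Proof. by rewrite ler0n. Qed.

Lemma flip_plus_set x : @flip_cfg N @^-1` plus_set x = ~` plus_set x.
Proof.
apply/seteqP; split=> u; rewrite /plus_set /flip_cfg /=; first by move/negP.
by move=> /negP.
Qed.

(** The limit is the magnetization at [x], since the spin flip exchanges the two
    boundary conditions. *)
Lemma gap_cvg x : (fun n => gap beta (vol n) x) @ \oo --> 2 * m (plus_set x) - 1.
Proof.
have cx := plus_set_cylinder x.
have -> : 2 * m (plus_set x) - 1 = m (plus_set x) - m (@flip_cfg N @^-1` plus_set x).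
  by rewrite flip_plus_set prob_setC //; lra.
have cf := flip_limit (cbox_increase Z2_origin) cx.
have cv := cvgB (vol_cvg cx) cf.
suff -> : (fun n => gap beta (vol n) x) = (fun n => gibbs beta (vol n) true (\1_(plus_set x)))
    - (fun n => gibbs beta (vol n) false (\1_(plus_set x))) by exact: cv.
by apply/funext => n; rewrite /gap plus_atE.
Qed.

Lemma gap_ge0 B (x : vertex N) : 0 <= gap beta B x.
Proof.
by rewrite subr_ge0; apply: gibbs_bc => //; exact: plus_at_incr.
Qed.

Lemma gap_beta0 B (x : vertex N) : beta = 0 -> x.1 \in B -> gap beta B x = 0.
Proof.
move=> b0 xB; apply/eqP; rewrite subr_eq0; apply/eqP.
have w1 u : weight beta (edges B) u = 1 :> R by rewrite /weight b0 mul0r expR0.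
have xS : x \in sites B by rewrite mem_sites.
have pS : perm_eq (sites B) (rcons (rem x (sites B)) x).
  by rewrite perm_sym perm_rcons perm_sym perm_to_rem.
have cst (l : seq (vertex N)) (c : R) s : isum l (fun=> c) s = isum l (fun=> c) (fun=> true).
  by elim: l s => //= y l IH s; rewrite !(IH (upd _ _ _)).
have E s : gibbs beta B s (plus_at x) =
    isum (rem x (sites B)) (fun=> 1) (fun=> true)
    / isum (@sites N B) (fun=> 1) (fun=> true).
  rewrite /gibbs; congr (_ / _).
    rewrite (isum_perm _ _ pS) -cats1 isum_cat.
    apply: etrans (cst (rem x (sites B)) 1 (fun=> s)).
    by apply: eq_isum => u /=; rewrite !w1 /plus_at /upd eqxx mulr1 mulr0 addr0.
  by rewrite (@eq_isum _ _ _ _ (fun=> 1)) //; exact: cst.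
by rewrite !E.
Qed.

Lemma slab_adj_sym : symmetric (@slab_adj N).
Proof.
move=> x y; rewrite /slab_adj -(sqrrN (x.1.1 - _)) -(sqrrN (x.1.2 - _)).
by rewrite -(sqrrN (x.2%:Z - _)) !opprB.
Qed.

Lemma half_neighbor (x y : vertex N) : slab_adj x y ->
  m (plus_set x) = 1 / 2 -> m (plus_set y) = 1 / 2.
Proof.
move=> xy mx.
have inB (z : vertex N) : \forall n \near \oo, z.1 \in vol n.
  have [_ mono cov] := cbox_increase Z2_origin.
  have [n0 zn0] := cov z.1; exists n0 => // n /= n0n.
  by move: zn0; rewrite !in_cbox /ball /=; lia.
have gx := @gap_cvg x; have gy := @gap_cvg y.
rewrite mx in gx.
have gx0 : (fun n => gap beta (vol n) x) @ \oo --> (0 : R).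
  by move: gx; rewrite (_ : 2 * (1 / 2) - 1 = 0 :> R) //; lra.
have y0 : 0 <= 2 * m (plus_set y) - 1.
  by apply: (cvgr_to_ge gy); apply: nearW => n; exact: gap_ge0.
suff y1 : 2 * m (plus_set y) - 1 <= 0 by lra.
case: (eqVneq beta 0) => [b0|bn0].
  apply: (cvgr_to_le gy); apply: filterS (inB y) => n yn.
  by rewrite gap_beta0.
have bp : 0 < beta by rewrite lt_neqAle eq_sym bn0.
have [c c0 cP] := gap_neighbor bp xy.
have cvy : (fun n => c * gap beta (vol n) y) @ \oo --> c * (2 * m (plus_set y) - 1).
  by apply: cvgMl_tmp.
have : c * (2 * m (plus_set y) - 1) <= 0.
  apply: (ler_cvg_to cvy gx0); apply: filterS (inB x) => n xn; exact: cP.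
by rewrite pmulr_rle0.
Qed.

(** Zero magnetization spreads from one site to its neighbours, hence through the
    connected slab. *)
Lemma half_all x y : m (plus_set x) = 1 / 2 -> m (plus_set y) = 1 / 2.
Proof.
move=> mx; case: x y mx => a i [b j] mx.
have {}mx : m (plus_set (b, i)) = 1 / 2.
  have [r [ar br]] : exists r : int, ball r a /\ ball r b.
    exists ((absz a.1)%:Z + (absz a.2)%:Z + (absz b.1)%:Z + (absz b.2)%:Z).
    by rewrite /ball; split; lia.
  apply: (@linked_ind (ball r) (fun v => m (plus_set (v, i)) = 1 / 2) a b _ (linked_ball ar br) mx).
  move=> v w _ _ vw.
  apply: half_neighbor; move: vw; rewrite /Z2_adj /slab_adj /= => /eqP ->.
  by rewrite subrr.
have up (k l : 'I_N) : l = k.+1 :> nat ->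
    (m (plus_set (b, k)) = 1 / 2 <-> m (plus_set (b, l)) = 1 / 2).
  move=> kl; have kb : slab_adj (b, k) (b, l).
    rewrite /slab_adj /= kl !subrr; apply/eqP; nia.
  split; apply: half_neighbor; first exact: kb.
  by rewrite slab_adj_sym.
have N0 : (0 < N)%N by apply: leq_ltn_trans (ltn_ord i).
pose o := Ordinal N0.
have all0 (k : 'I_N) : m (plus_set (b, k)) = 1 / 2 <-> m (plus_set (b, o)) = 1 / 2.
  case: k => k kN; elim: k kN => [|k IH] kN.
    by rewrite (_ : Ordinal kN = o) //; exact: val_inj.
  rewrite -(IH (ltnW kN)); apply: iff_sym; exact: up.
by apply/all0; rewrite -(all0 i).
Qed.

(** With zero magnetization the plus state does not see the sign of the boundary
    condition: the number of plus spins in the support of an increasing event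
    [A] minus the indicator of [A] is increasing, so the two boundary conditions
    differ on [A] by at most the sum of their gaps. *)
Lemma flip_invariant A : (forall x, m (plus_set x) = 1 / 2) ->
  cylinder A -> incr_event A -> m (@flip_cfg N @^-1` A) = m A.
Proof.
move=> half [F AF] iA; have cA : cylinder A by exists F.
have cf := flip_limit (cbox_increase Z2_origin) cA.
have cv := vol_cvg cA.
apply/eqP; rewrite eq_le; apply/andP; split.
  apply: (ler_cvg_to cf cv); apply: nearW => n.
  by apply: gibbs_bc => //; exact: indic_incr.
pose f (u : config N) : R := \sum_(x <- enum_fset F) plus_at x u + (1 - \1_A u).
have f0 u : 0 <= f u.
  apply: addr_ge0; first by apply: sumr_ge0 => x _; exact: plus_at_ge0.
  by rewrite subr_ge0 indicE; case: (_ \in _).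
have fi : cfg_incr f.
  move=> u v uv; rewrite /f.
  have su : \sum_(x <- enum_fset F) plus_at x u <= \sum_(x <- enum_fset F) plus_at x v :> R.
    by apply: ler_sum => x _; exact: plus_at_incr.
  case: (pselect (forall x, x \in F -> u x = v x)) => [E|/existsNP[x /not_implyP[xF nuv]]].
    have -> : \1_A v = \1_A u :> R.
      rewrite !indicE; congr (_%:R); congr nat_of_bool.
      apply/idP/idP => /set_mem H; apply/mem_set; apply: AF H => x xF; by rewrite E.
    by rewrite lerD2r.
  have su1 : \sum_(x <- enum_fset F) plus_at x u + 1 <= \sum_(x <- enum_fset F) plus_at x v :> R.
    rewrite (big_rem x) //= [leRHS](big_rem x) //= addrAC.
    apply: lerD; last by apply: ler_sum => z _; exact: plus_at_incr.
    by rewrite /plus_at; move: nuv (uv x); case: (u x); case: (v x) => //= nuv h;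
      rewrite ?add0r //; have := h isT.
  have : \1_A v <= 1 + \1_A u :> R.
    by rewrite !indicE; case: (_ \in _); case: (_ \in _); rewrite /= ?addr0 ?add0r; lra.
  by lra.
have step n : gibbs beta (vol n) true (\1_A) <=
    gibbs beta (vol n) false (\1_A) + \sum_(x <- enum_fset F) gap beta (vol n) x.
  have fE s : gibbs beta (vol n) s f =
      \sum_(x <- enum_fset F) gibbs beta (vol n) s (plus_at x)
      + (1 - gibbs beta (vol n) s (\1_A)).
    rewrite gibbsD gibbs_sum; congr (_ + _).
    rewrite -[X in X - _](@gibbs1 _ N beta (vol n) s) -mulN1r -gibbsZ -gibbsD.
    by congr gibbs; apply/funext => u; rewrite mulN1r.
  have := gibbs_bc beta0 (vol n) f0 fi; rewrite !fE /gap big_split /= sumrN.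
  by lra.
have cvs : (fun n => gibbs beta (vol n) false (\1_A) + \sum_(x <- enum_fset F) gap beta (vol n) x)
    @ \oo --> m (@flip_cfg N @^-1` A) + 0.
  apply: cvgD; first exact: cf.
  elim: (enum_fset F) => [|x l IH].
    by under eq_fun do rewrite big_nil; exact: cvg_cst.
  under eq_fun do rewrite big_cons.
  have gx : (fun n => gap beta (vol n) x) @ \oo --> (0 : R).
    by have := @gap_cvg x; rewrite half (_ : 2 * (1 / 2) - 1 = 0 :> R) //; lra.
  have h := cvgD gx IH; rewrite addr0 in h; exact: h.
rewrite -[leRHS]addr0; apply: (ler_cvg_to cv cvs); exact: nearW.
Qed.

End State.

(** * Arms, rings and trifurcation blocks *)

Lemma exit_first (X B : pred Z2) x y : linked X x y -> B x -> ~~ B y ->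
  exists a b, [/\ linked (fun z => X z && B z) x a, Z2_adj a b, X b & ~~ B b].
Proof.
move=> [p [pp <- Xp]]; elim: p x pp Xp => [|z p IH] x /=.
  by move=> _ _ ->.
move=> /andP[xz pp] /and3P[Xx Xz Xp] Bx By.
case: (boolP (B z)) => Bz; last first.
  by exists x, z; split=> //; apply: linked_refl; rewrite /= Xx.
have [|a [b [za ab Xb Bb]]] := IH z pp _ Bz By; first by rewrite /= Xz.
exists a, b; split=> //; apply: linked_trans za.
by apply: linked_step; rewrite //= ?Xx ?Xz.
Qed.

Lemma exit_last (X B : pred Z2) x y : linked X x y -> B x -> ~~ B y ->
  exists a b, [/\ linked (fun z => X z && ~~ B z) b y, Z2_adj a b, X a & B a].
Proof.
move=> /linked_sym yx Bx By.
have [|b [a [yb ba Xa]]] := @exit_first X (fun z => ~~ B z) y x yx By; first by rewrite /= negbK.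
rewrite /= negbK => Ba; exists a, b; split=> //; last by rewrite Z2_adj_sym.
exact: linked_sym.
Qed.

Lemma linked_map (X Y : pred Z2) (h : Z2 -> Z2) x y :
  (forall a b, Z2_adj a b -> Z2_adj (h a) (h b)) ->
  (forall a, X a -> Y (h a)) -> linked X x y -> linked Y (h x) (h y).
Proof.
move=> hadj XY xy; have [Xx _] := linked_ends xy.
apply: (@linked_ind X (fun z => linked Y (h x) (h z)) x y _ xy) => [a b Xa Xb ab|].
  by move=> /linked_trans; apply; apply: linked_step; auto.
by apply: linked_refl; exact: XY.
Qed.

Lemma ball_le (k n : int) z : k <= n -> ball k z -> ball n z.
Proof. by rewrite /ball => kn; lia. Qed.

Lemma ball_adj (k : int) a b : Z2_adj a b -> ball k a -> ball (k + 1) b.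
Proof. by rewrite Z2_adjP /ball; case: a b => [a1 a2] [b1 b2] /=; lia. Qed.

(** The vertices outside a block that have a neighbour in it. *)
Definition ring (k : int) : pred Z2 := fun x =>
  ((x.1 == k + 1) || (x.1 == - k - 1)) && (- k <= x.2 <= k) ||
  ((x.2 == k + 1) || (x.2 == - k - 1)) && (- k <= x.1 <= k).

Lemma ring_adj k a b : Z2_adj a b -> ball k a -> ~~ ball k b -> ring k b.
Proof.
rewrite Z2_adjP /ball /ring; case: a b => [a1 a2] [b1 b2] /=.
by move=> /orP[/andP[/eqP -> /orP[]/eqP ->]|/andP[/eqP -> /orP[]/eqP ->]]; lia.
Qed.

Lemma ring_nbr k x : ring k x -> exists2 w, ball k w & Z2_adj w x.
Proof.
case: x => a b; rewrite /ring /=.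
move=> /orP[/andP[/orP[]/eqP -> H]|/andP[/orP[]/eqP -> H]].
- by exists (k, b); rewrite ?Z2_adjP /ball /=; lia.
- by exists (- k, b); rewrite ?Z2_adjP /ball /=; lia.
- by exists (a, k); rewrite ?Z2_adjP /ball /=; lia.
- by exists (a, - k); rewrite ?Z2_adjP /ball /=; lia.
Qed.

Lemma ring_ball k x : ring k x -> ball (k + 1) x.
Proof. by move=> /ring_nbr[w kw wx]; exact: ball_adj kw. Qed.

Definition escapes (S : pred Z2) (k n : int) (x : Z2) : Prop :=
  exists2 y, ~~ ball n y & linked (annulus S k (n + 1)) x y.

Definition reach (S : pred Z2) (k n : int) : Prop :=
  exists2 x, ring k x & escapes S k n x.

Lemma annulus_sub (S S' : pred Z2) k k' n n' : k <= k' -> n' <= n ->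
  (forall z, S' z -> S z) -> {subset annulus S' k' n' <= annulus S k n}.
Proof.
move=> kk nn SS z /andP[/andP[/SS Sz kz] nz]; apply/andP; split; last exact: ball_le nz.
by apply/andP; split=> //; apply: contra kz; exact: ball_le.
Qed.

Lemma escapes_mono (S S' : pred Z2) k n x : (forall z, S z -> S' z) ->
  escapes S k n x -> escapes S' k n x.
Proof. by move=> SS [y yn xy]; exists y => //; apply: linked_sub xy; exact: annulus_sub. Qed.

Lemma eq_escapes (S S' : pred Z2) k n x :
  (forall z, ~~ ball k z -> ball (n + 1) z -> S z = S' z) -> escapes S k n x -> escapes S' k n x.
Proof.
move=> SS [y yn xy]; exists y => //; apply: linked_sub xy => z.
by move=> /andP[/andP[Sz kz] nz]; rewrite unfold_in /annulus -SS // Sz kz.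
Qed.

Lemma reach_inner (S : pred Z2) k k' n : 0 <= k -> k <= k' -> k' <= n ->
  reach S k n -> reach S k' n.
Proof.
move=> k0 kk kn [x xk [y yn xy]].
case: (eqVneq k k') => [<-|nk]; first by exists x => //; exists y.
have xk' : ball k' x by apply: ball_le (ring_ball xk); clear -kk nk; lia.
have yk' : ~~ ball k' y by apply: contra yn; exact: ball_le.
have [a [b [bY ab _ ak]]] := exit_last xy xk' yk'.
have [/andP[_ bk] _] := linked_ends bY.
exists b; first exact: ring_adj ab ak bk.
exists y => //; apply: linked_sub bY => z /andP[/andP[/andP[Sz _] nz] kz].
by rewrite unfold_in /annulus Sz nz andbT; exact: kz.
Qed.

Lemma escapes_outer (S : pred Z2) k n n' x : k <= n -> n <= n' -> ring k x ->
  escapes S k n' x -> escapes S k n x.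
Proof.
move=> kn nn xk [y yn xy].
have n1 : n <= n + 1 by clear; lia.
have yn' : ~~ ball n y by apply: contra yn; exact: ball_le.
have [/andP[/andP[Sx kx] _] _] := linked_ends xy.
case: (boolP (ball n x)) => xn; last first.
  exists x => //; apply: linked_refl; rewrite /annulus Sx kx /=.
  by apply: ball_le (ring_ball xk); clear -kn; lia.
have [a [b [xa ab /andP[/andP[Sb kb] _] bn]]] := exit_first xy xn yn'.
have [_ /andP[/andP[/andP[Sa ka] _] an]] := linked_ends xa.
exists b => //; apply: (@linked_trans _ a).
  apply: linked_sub xa => z /andP[/andP[/andP[Sz kz] _] nz].
  by rewrite unfold_in /annulus Sz kz; exact: ball_le n1 nz.
apply: linked_step => //; rewrite /annulus ?Sa ?ka ?Sb ?kb /=.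
  exact: ball_le n1 an.
exact: ball_adj an.
Qed.

Lemma reach_outer (S : pred Z2) k n n' : k <= n -> n <= n' ->
  reach S k n' -> reach S k n.
Proof. by move=> kn nn [x xk H]; exists x => //; exact: escapes_outer H. Qed.

(** The eight symmetries of the square fixing the origin. *)
Definition d4 (g : bool * bool * bool) (v : Z2) : Z2 :=
  let: (s, t, w) := g in
  let: (a, b) := if w then (v.2, v.1) else v in
  (if s then - a else a, if t then - b else b).

Definition d4_inv (g : bool * bool * bool) : bool * bool * bool :=
  let: (s, t, w) := g in if w then (t, s, w) else g.

Lemma d4_invK g : d4_inv (d4_inv g) = g.
Proof. by case: g => -[s t] []. Qed.

Lemma d4K g : cancel (d4 g) (d4 (d4_inv g)).
Proof. by case: g => -[[] []] [] [a b]; rewrite /d4 /= ?opprK. Qed.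

Lemma d4_invVK g : cancel (d4 (d4_inv g)) (d4 g).
Proof. by move=> v; rewrite -{1}(d4_invK g) d4K. Qed.

Lemma d4_isometry g (a b : Z2) :
  ((d4 g a).1 - (d4 g b).1) ^+ 2 + ((d4 g a).2 - (d4 g b).2) ^+ 2
  = (a.1 - b.1) ^+ 2 + (a.2 - b.2) ^+ 2.
Proof. by case: g a b => -[[] []] [] [a1 a2] [b1 b2]; rewrite /d4 /=; ring. Qed.

Lemma d4_adj g a b : Z2_adj a b -> Z2_adj (d4 g a) (d4 g b).
Proof. by rewrite /Z2_adj d4_isometry. Qed.

Lemma d4_ball g k v : ball k (d4 g v) = ball k v.
Proof. by case: g v => -[[] []] [] [a b]; rewrite /d4 /ball /=; lia. Qed.

Definition corner_piece (k : int) : pred Z2 := fun x => (x.1 == k + 1) && (0 <= x.2 <= k).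

Lemma ring_d4 k x : ring k x -> exists g, corner_piece k (d4 (d4_inv g) x).
Proof.
case: x => a b; rewrite /ring /=.
move=> /orP[/andP[/orP[]/eqP -> H]|/andP[/orP[]/eqP -> H]].
- case: (lerP 0 b) => b0; [exists (false, false, false)|exists (false, true, false)];
  by rewrite /corner_piece /d4 /=; lia.
- case: (lerP 0 b) => b0; [exists (true, false, false)|exists (true, true, false)];
  by rewrite /corner_piece /d4 /=; lia.
- case: (lerP 0 a) => b0; [exists (false, false, true)|exists (true, false, true)];
  by rewrite /corner_piece /d4 /=; lia.
- case: (lerP 0 a) => b0; [exists (false, true, true)|exists (true, true, true)];
  by rewrite /corner_piece /d4 /=; lia.
Qed.

(** Pulling the configuration back by [g] turns the arms from the eight half
    sides into images of a single event under the symmetries of the square. *)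
Definition arm (g : bool * bool * bool) (k n : int) (S : pred Z2) : Prop :=
  exists2 x, corner_piece k x & escapes (S \o d4 g) k n x.

Lemma reach_arm S k n : reach S k n -> exists g, arm g k n S.
Proof.
move=> [x /ring_d4[g gx] [y yn xy]]; exists g; exists (d4 (d4_inv g) x) => //.
exists (d4 (d4_inv g) y); first by rewrite d4_ball.
apply: linked_map xy => [a b|z]; first exact: d4_adj.
by rewrite /annulus /= d4_invVK !d4_ball.
Qed.

Lemma arm_escape g k n S : arm g k n S ->
  exists2 x, corner_piece k x & escapes S k n (d4 g x).
Proof.
move=> [x kx [y yn xy]]; exists x => //; exists (d4 g y); first by rewrite d4_ball.
apply: linked_map xy => [a b|z]; first exact: d4_adj.
by rewrite /annulus /= !d4_ball.
Qed.

(** The block is required to be fully occupied so that it joins its arms into one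
    component, which splits into at least three when the block is removed. *)
Definition trifurcation (k n : int) (S : pred Z2) : Prop :=
  (forall z, ball k z -> S z) /\ exists u1 u2 u3,
  [/\ ring k u1 /\ escapes S k n u1, ring k u2 /\ escapes S k n u2,
      ring k u3 /\ escapes S k n u3 &
      [/\ ~ linked (annulus S k n) u1 u2, ~ linked (annulus S k n) u2 u3 &
          ~ linked (annulus S k n) u1 u3]].

Definition plus_dirs := [:: (false, true, false); (false, false, true); (true, false, false)].
Definition minus_dirs := [:: (false, false, false); (true, false, true); (true, true, false)].

Lemma six_arms_trifurcation (k n : int) (P M : pred Z2) : 0 <= k -> k < n ->
  (forall x, P x -> ~~ M x) -> (forall z, ball k z -> P z) ->
  (forall g, g \in plus_dirs -> arm g k n P) ->
  (forall g, g \in minus_dirs -> arm g k n M) -> trifurcation k n P.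
Proof.
move=> k0 kn PM kP aP aM.
have [[a1 y1] /andP[/= /eqP -> h1] e1] := arm_escape (aP (false, true, false) isT).
have [[a3 y3] /andP[/= /eqP -> h3] e3] := arm_escape (aP (false, false, true) isT).
have [[a5 y5] /andP[/= /eqP -> h5] e5] := arm_escape (aP (true, false, false) isT).
have [[a2 y2] /andP[/= /eqP -> h2] [z2 o2 l2]] := arm_escape (aM (false, false, false) isT).
have [[a4 y4] /andP[/= /eqP -> h4] [z4 o4 l4]] := arm_escape (aM (true, false, true) isT).
have [[a6 y6] /andP[/= /eqP -> h6] [z6 o6 l6]] := arm_escape (aM (true, true, false) isT).
rewrite /d4 /= in e1 e3 e5 l2 l4 l6.
have off z : annulus M k (n + 1) z -> off_ball M k z by case/andP.
have h1' : - k <= - y1 <= 0 by clear -h1; lia.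
have h4' : - k <= - y4 <= 0 by clear -h4; lia.
have h6' : - k <= - y6 <= 0 by clear -h6; lia.
have opk : - (k + 1) = - k - 1 by rewrite opprD.
rewrite opk in e5 l6.
have sep := six_arms_separate k0 kn PM h1' h2 h3 h4' h5 h6'
  (linked_sub off l2) o2 (linked_sub off l4) o4 (linked_sub off l6) o6.
split=> //; exists (k + 1, - y1), (y3, k + 1), (- k - 1, y5); split.
- by split=> //; rewrite /ring /=; clear -h1 k0; lia.
- by split=> //; rewrite /ring /=; clear -h3 k0; lia.
- by split=> //; rewrite /ring /=; clear -h5 k0; lia.
by case: sep.
Qed.

(** * Disjoint trifurcation blocks in a large box *)

Definition shift (c z : Z2) : Z2 := (z.1 + c.1, z.2 + c.2).
Definition unshift (c z : Z2) : Z2 := (z.1 - c.1, z.2 - c.2).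

Lemma shiftK c : cancel (shift c) (unshift c).
Proof. by case=> a b; rewrite /shift /unshift /= !addrK. Qed.

Lemma unshiftK c : cancel (unshift c) (shift c).
Proof. by case=> a b; rewrite /shift /unshift /= !subrK. Qed.

Lemma shift_isometry c (a b : Z2) :
  ((shift c a).1 - (shift c b).1) ^+ 2 + ((shift c a).2 - (shift c b).2) ^+ 2
  = (a.1 - b.1) ^+ 2 + (a.2 - b.2) ^+ 2.
Proof. by rewrite /shift /=; ring. Qed.

Lemma shift_adj c a b : Z2_adj a b -> Z2_adj (shift c a) (shift c b).
Proof. by rewrite /Z2_adj shift_isometry. Qed.

Lemma unshift_adj c a b : Z2_adj a b -> Z2_adj (unshift c a) (unshift c b).
Proof. by rewrite -{1}(unshiftK c a) -{1}(unshiftK c b) {1}/Z2_adj shift_isometry. Qed.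

Section BlockCount.
Variables (S : pred Z2) (k r : int) (n : nat) (X : seq Z2).
Hypotheses (k0 : 0 <= k) (uX : uniq X) (nr : n%:Z + n%:Z <= r).
Hypothesis Xin : forall c, c \in X -> ball (n%:Z - 1 - k) c.
Hypothesis Xdisj : forall c c' z, c \in X -> c' \in X ->
  ball k (unshift c z) -> ball k (unshift c' z) -> c = c'.
Hypothesis Xtri : forall c, c \in X -> trifurcation k r (S \o shift c).

Let V := fset_sub_type (cbox Z2_origin n).
Let adjV : rel V := fun x y => Z2_adj (fsval x) (fsval y).

Let adjV_sym : symmetric adjV. Proof. by move=> x y; exact: Z2_adj_sym. Qed.

Let ballP z : (z \in cbox Z2_origin n) = ball n%:Z z.
Proof. by rewrite in_cbox /= !subr0; case: z. Qed.

Let lift_link (Y : pred Z2) (W : {set V}) (x y : V) :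
  (forall z : V, Y (fsval z) -> z \in W) -> (forall z, Y z -> ball n%:Z z) ->
  linked Y (fsval x) (fsval y) -> connect (within adjV W) x y.
Proof.
move=> YW Yn [p [pp lp Yp]]; elim: p x pp lp Yp => [|z p IH] x /=.
  by move=> _ /val_inj -> _; exact: connect0.
move=> /andP[xz pp] lp /and3P[Yx Yz Yp].
have zV : z \in cbox Z2_origin n by rewrite ballP Yn.
apply: (@connect_trans _ _ [` zV]%fset); last by apply: IH => //=; rewrite Yz.
apply: connect1; rewrite /within; apply/and3P; split; first exact: xz.
  exact: YW.
exact: YW.
Qed.

Let drop_link (Y : pred Z2) (W : {set V}) (x y : V) :
  (forall z : V, z \in W -> Y (fsval z)) -> x \in W ->
  connect (within adjV W) x y -> linked Y (fsval x) (fsval y).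
Proof.
move=> WY xW /connectP[p + ->]; elim: p x xW => [|z p IH] x xW /=.
  by move=> _; apply: linked_refl; exact: WY.
move=> /andP[/and3P[xz _ zW] pp]; apply: linked_trans (IH z zW pp).
by apply: linked_step => //; exact: WY.
Qed.

Let G : {set V} := [set x : V | S (fsval x)].
Let blk (c : Z2) : {set V} := [set x : V | (c \in X) && ball k (unshift c (fsval x))].
Let Y : {set V} := [set x : V | ~~ ball (n%:Z - 1) (fsval x)].

Let shift_in c z : c \in X -> ball k z -> ball (n%:Z - 1) (shift c z).
Proof. by move=> /Xin; rewrite /ball /shift /=; clear; lia. Qed.

Let blk_sub c : blk c \subset G.
Proof.
apply/fintype.subsetP => x; rewrite !inE => /andP[cX xk].
by have [/(_ _ xk)] := Xtri cX; rewrite /= unshiftK.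
Qed.

Let blk_conn c x y : x \in blk c -> y \in blk c -> y \in branch adjV (blk c) x.
Proof.
rewrite !inE => /andP[cX xk] /andP[_ yk].
have := linked_ball xk yk => /(@linked_map _ (fun z => ball k (unshift c z)) (shift c)).
rewrite !unshiftK => h; apply: (lift_link _ _ (h _ _)).
- by move=> z zk; rewrite inE cX.
- move=> z /(shift_in cX); rewrite unshiftK; apply: ball_le; clear; lia.
- exact: shift_adj.
- by move=> z; rewrite shiftK.
Qed.

Let blk_disj c c' : c != c' -> [disjoint blk c & blk c']%B.
Proof.
move=> cc; apply/pred0P => x /=; apply/negbTE/negP => /andP[].
rewrite !inE => /andP[cX xk] /andP[c'X xk']; move/eqP: cc; apply.
exact: Xdisj xk xk'.
Qed.

Let boundary_card : (#|Y| <= 4 * (2 * n + 1))%N.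
Proof.
pose side := [seq i%:Z - n%:Z | i <- iota 0 (2 * n + 1)].
pose l : seq Z2 := [seq (n%:Z, j) | j <- side] ++ [seq (- n%:Z, j) | j <- side]
  ++ [seq (j, n%:Z) | j <- side] ++ [seq (j, - n%:Z) | j <- side].
have -> : (4 * (2 * n + 1) = size l)%N.
  by rewrite !size_cat !size_map !size_iota; lia.
rewrite cardE -(size_map (@fsval _ _)); apply: uniq_leq_size.
  by rewrite map_inj_uniq ?enum_uniq //; exact: val_inj.
have sideP j : - n%:Z <= j <= n%:Z -> j \in side.
  move=> hj; apply/mapP; exists (absz (j + n%:Z)%R); last by lia.
  by rewrite mem_iota; lia.
have onl z : ball n%:Z z -> ~~ ball (n%:Z - 1) z -> z \in l.
  case: z => a b; rewrite /ball /= => h2 h1; rewrite !mem_cat.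
  have : a = n%:Z \/ a = - n%:Z \/ b = n%:Z \/ b = - n%:Z by move: h1 h2; clear; lia.
  by case=> [->|[->|[->|->]]]; apply/or4P; [apply: Or41|apply: Or42|apply: Or43|apply: Or44];
    apply: map_f; apply: sideP; move: h2; clear; lia.
move=> z /mapP[x]; rewrite mem_enum inE => xY ->.
by apply: onl => //; rewrite -ballP; exact: valP.
Qed.

Lemma block_count : (size X <= 4 * (2 * n + 1))%N.
Proof.
apply: leq_trans boundary_card.
apply: (count_trifurcations adjV_sym blk_sub blk_conn blk_disj uX) => c cX.
have [_ [u1 [u2 [u3 [[r1 e1] [r2 e2] [r3 e3] [n12 n23 n13]]]]]] := Xtri cX.
have cin : ball (n%:Z - 1 - k) c := Xin cX.
(* the part of the ball of radius n off the block *)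
pose Q : pred Z2 := fun z => S z && ~~ ball k (unshift c z) && ball n%:Z z.
have start u : ring k u -> escapes (S \o shift c) k r u ->
    exists x : V, fsval x = shift c u /\ opens adjV G blk c Y x.
  move=> ur [y yr uy].
  have un : ball n%:Z (shift c u).
    by move: (ring_ball ur) cin; rewrite /ball /shift /=; clear -k0; lia.
  have uV : shift c u \in cbox Z2_origin n by rewrite ballP.
  exists [` uV]%fset; split=> //.
  have [/andP[/andP[Su ku] _] _] := linked_ends uy.
  have uG : [` uV]%fset \in G :\: blk c.
    by rewrite !inE /= shiftK cX /= ku.
  apply/and3P; split=> //.
    have [w kw wu] := ring_nbr ur.
    have wV : shift c w \in cbox Z2_origin n.
      by rewrite ballP; apply: ball_le (shift_in cX kw); clear; lia.
    apply/existsP; exists [` wV]%fset; rewrite inE /= shiftK cX kw /=.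
    exact: shift_adj.
  have suy : linked (fun z => S z && ~~ ball k (unshift c z)) (shift c u) (shift c y).
    apply: linked_map uy => [a b|z /andP[]]; first exact: shift_adj.
    by rewrite shiftK.
  have yn : ~~ ball n%:Z (shift c y).
    by move: yr cin nr; rewrite /ball /shift /=; clear -k0; lia.
  have [a [b [ua ab _ bn]]] := exit_first suy un yn.
  have [_ /andP[Qa an]] := linked_ends ua.
  have aV : a \in cbox Z2_origin n by rewrite ballP.
  rewrite disjoint_subset; apply/subsetPn; exists [` aV]%fset.
    rewrite inE; apply: (@lift_link Q) => //=.
    - move=> z /andP[/andP[Sz kz] _]; rewrite !inE Sz andbT.
      by rewrite negb_and kz orbT.
    - by move=> z /andP[].
  rewrite !inE negbK /=; apply: contra bn => an1.
  by have := ball_adj ab an1; rewrite subrK.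
have [x1 [v1 o1]] := start _ r1 e1.
have [x2 [v2 o2]] := start _ r2 e2.
have [x3 [v3 o3]] := start _ r3 e3.
have sep x x' u u' : fsval x = shift c u -> fsval x' = shift c u' ->
    x \in G :\: blk c -> ~ linked (annulus (S \o shift c) k r) u u' ->
    branch adjV (G :\: blk c) x != branch adjV (G :\: blk c) x'.
  move=> vx vx' xG nl; apply/eqP => E; apply: nl.
  have : x' \in branch adjV (G :\: blk c) x by rewrite E branch_refl.
  rewrite inE => xx'.
  have lQ : linked Q (fsval x) (fsval x').
    apply: drop_link xG xx' => z; rewrite !inE cX /= => /andP[kz Sz].
    by rewrite /Q Sz kz -ballP; exact: valP.
  rewrite -(shiftK c u) -(shiftK c u') -vx -vx'.
  apply: linked_map lQ => [a b|]; first exact: unshift_adj.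
  move=> z /andP[/andP[Sz kz] nz]; rewrite /annulus /= unshiftK Sz kz /=.
  by move: nz cin nr; rewrite /ball /unshift /=; clear -k0; lia.
have inG x : opens adjV G blk c Y x -> x \in G :\: blk c by case/and3P.
exists x1, x2, x3; split=> //; split.
- by apply: sep n12; auto.
- by apply: sep n23; auto.
- by apply: sep n13; auto.
Qed.

End BlockCount.

(** * Percolation of columns *)

Section Columns.
Context {N : nat}.
Implicit Types (u v : config N) (S : pred Z2) (E : pred Z2 -> Prop).

Definition plus_columns u : pred Z2 := fun c => signed_column true u c.

Lemma plus_columns_mono u v c : cfg_le u v -> plus_columns u c -> plus_columns v c.
Proof.
move=> uv; rewrite /plus_columns /signed_column /column_sum => h; apply: lt_le_trans h _.
apply: ler_sum => k _; move: (uv (c, k)).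
by case: (u (c, k)) => [/(_ isT) ->|_] //; case: (v (c, k)).
Qed.

Lemma plus_columns_eq u v c : (forall k, u (c, k) = v (c, k)) ->
  plus_columns u c = plus_columns v c.
Proof.
move=> uv; rewrite /plus_columns /signed_column /column_sum.
by congr (_ < _); apply: eq_bigr => k _; rewrite uv.
Qed.

Lemma minus_columnsE u c : signed_column false u c = plus_columns (flip_cfg u) c.
Proof.
rewrite /plus_columns /signed_column -oppr_gt0 /column_sum -sumrN; congr (_ < _).
by apply: eq_bigr => k _; rewrite /flip_cfg; case: (u _).
Qed.

Lemma plus_minus_columns u c : plus_columns u c -> ~~ plus_columns (flip_cfg u) c.
Proof.
by rewrite -minus_columnsE /plus_columns /signed_column -leNgt; exact: ltW.
Qed.

Lemma plus_columns_full u c : (0 < N)%N -> (forall k, u (c, k)) -> plus_columns u c.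
Proof.
move=> N0 uc; rewrite /plus_columns /signed_column /column_sum.
under eq_bigr do rewrite uc.
by rewrite sumr_const card_ord -mulr_natr mul1r; lia.
Qed.

Definition column_event E : set (config N) := [set u | E (plus_columns u)].

Definition local_event (M : nat) E : Prop :=
  forall S S', (forall z, ball M%:Z z -> S z = S' z) -> E S -> E S'.

Definition increasing_event E : Prop :=
  forall S S', (forall z, S z -> S' z) -> E S -> E S'.

Lemma in_vol (M : nat) z : (z \in cbox Z2_origin M) = ball M%:Z z.
Proof. by rewrite in_cbox /= !subr0; case: z. Qed.

Lemma column_event_cylinder M E : local_event M E -> cylinder (column_event E).
Proof.
move=> EM; exists [fset x in sites (cbox Z2_origin M)]%fset => u v uv.
apply: EM => z zM; apply: plus_columns_eq => k; apply: uv.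
by rewrite inE mem_sites in_vol.
Qed.

Lemma column_event_incr E : increasing_event E -> incr_event (column_event E).
Proof. by move=> Ei u v uv; apply: Ei => z; exact: plus_columns_mono. Qed.

Lemma local_reach (k n : nat) : local_event n.+1 (fun S => reach S k%:Z n%:Z).
Proof.
move=> S S' SS [x xk xn]; exists x => //; apply: eq_escapes xn => z _ zn.
by apply: SS; rewrite -[n.+1]addn1.
Qed.

Lemma incr_reach k n : increasing_event (fun S => reach S k n).
Proof. by move=> S S' SS [x xk xn]; exists x => //; exact: escapes_mono xn. Qed.

Lemma local_arm g (k n : nat) : local_event n.+1 (fun S => arm g k%:Z n%:Z S).
Proof.
move=> S S' SS [x xk xn]; exists x => //; apply: eq_escapes xn => z _ zn /=.
by apply: SS; rewrite d4_ball -[n.+1]addn1.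
Qed.

Lemma incr_arm g k n : increasing_event (fun S => arm g k n S).
Proof.
by move=> S S' SS [x xk xn]; exists x => //; apply: escapes_mono xn => z; exact: SS.
Qed.

Lemma local_trifurcation (k n : nat) : (k <= n)%N ->
  local_event n.+1 (trifurcation k%:Z n%:Z).
Proof.
move=> kn S S' SS.
have ann x y : linked (annulus S' k%:Z n%:Z) x y -> linked (annulus S k%:Z n%:Z) x y.
  apply: linked_sub => z /andP[/andP[Sz kz] nz]; apply/andP; split=> //.
  rewrite SS ?Sz ?kz //; apply: ball_le nz; clear; lia.
have esc x : escapes S k%:Z n%:Z x -> escapes S' k%:Z n%:Z x.
  by apply: eq_escapes => z _ zn; apply: SS; rewrite -[n.+1]addn1.
move=> [kS [u1 [u2 [u3 [[r1 e1] [r2 e2] [r3 e3] [n12 n23 n13]]]]]]; split.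
  move=> z zk; rewrite -SS ?kS //; apply: ball_le zk; move: kn; clear; lia.
exists u1, u2, u3; split; [by split; auto|by split; auto|by split; auto|].
by split=> /ann h; [exact: n12 h|exact: n23 h|exact: n13 h].
Qed.

End Columns.

Lemma isum_ge_full {V : eqType} {R : realType} (l : seq V) (F : (V -> bool) -> R) s :
  (forall u, 0 <= F u) -> F (fun x => (x \in l) || s x) <= isum l F s.
Proof.
move=> F0; elim: l s => [|x l IH] s /=.
  by rewrite (_ : (fun y => _) = s) //; apply/funext => y; rewrite in_nil.
apply: ler_wpDr; first exact: isum_ge0.
apply: le_trans (IH (upd s x true)); rewrite (_ : (fun y => _) = (fun y => (y \in l) || upd s x true y)) //.
by apply/funext => y; rewrite inE /upd; case: eqP => _ /=; rewrite ?orbT // orbF.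
Qed.

Section Percolation.
Context {R : realType} {N : nat}.
Hypothesis N0 : (0 < N)%N.
Variable beta : R.
Hypothesis beta0 : 0 <= beta.
Variable m : set (config N) -> R.
Hypothesis hm : infinite_volume beta true m.
Implicit Types (E : pred Z2 -> Prop).
Local Notation CE := (@column_event N).

Lemma prob_move (g g' : Z2 -> Z2) (M : nat) E : cancel g g' -> cancel g' g ->
  (forall a b : Z2, ((g a).1 - (g b).1) ^+ 2 + ((g a).2 - (g b).2) ^+ 2
     = (a.1 - b.1) ^+ 2 + (a.2 - b.2) ^+ 2) ->
  (forall n v, (g v \in cbox (g Z2_origin) n) = (v \in cbox Z2_origin n)) ->
  local_event M E ->
  m [set u | E (plus_columns u \o g')] = m (CE E).
Proof.
move=> gg' g'g iso gbox EM.
exact: (prob_symmetry hm gg' g'g iso gbox (column_event_cylinder EM)).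
Qed.

Lemma prob_arm g (k n : nat) :
  m (CE (fun S => arm g k%:Z n%:Z S))
  = m (CE (fun S => arm (false, false, false) k%:Z n%:Z S)).
Proof.
rewrite -(@prob_move (d4 (d4_inv g)) (d4 g) n.+1 (arm (false, false, false) k n)).
- have E (S : pred Z2) : S \o d4 (false, false, false) = S by apply/funext => -[].
  by congr m; apply/funext => u; rewrite /column_event /arm /mkset E.
- exact: d4_invVK.
- exact: d4K.
- exact: d4_isometry.
- move=> v' v; rewrite (_ : d4 _ Z2_origin = Z2_origin); last by case: g => -[[] []] [].
  by rewrite !in_vol d4_ball.
- exact: local_arm.
Qed.

Lemma prob_shift c (M : nat) E : local_event M E ->
  m [set u | E (plus_columns u \o shift c)] = m (CE E).
Proof.
move=> EM; apply: (@prob_move (unshift c) (shift c) M) => //.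
- exact: unshiftK.
- exact: shiftK.
- by move=> a b; rewrite /unshift /=; ring.
- by move=> n v; rewrite !in_cbox /unshift /ball /=; lia.
Qed.

Section ReachHigh.
Variable theta : R.
Hypothesis theta0 : 0 < theta.
Hypothesis reach_theta : forall n : nat, theta <= m (CE (fun S => reach S 0%N%:Z n%:Z)).

(** A large block reaches far away with probability close to one.  A path
    from the origin to distance [n] first runs up to a smaller distance [n'], and
    then leaves a box of radius [q > n'] for good.  By [prob_local] the
    probability of both is at most that of the first, in the box with plus
    boundary, times that of the second.  For suitable [n'] and [q] the first
    factor is close to the infimum of the probabilities of reaching any
    distance, hence the second factor is close to 1. *)
Lemma reach_high (eps : R) : 0 < eps ->
  exists k : nat, forall n : nat, (k <= n)%N ->
    1 - eps <= m (CE (fun S => reach S k%:Z n%:Z)).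
Proof.
move=> eps0; pose a (n : nat) := m (CE (fun S => reach S 0%N%:Z n%:Z)).
pose I := inf (range a).
have hI : has_inf (range a).
  split; first by exists (a 0%N), 0%N.
  by exists theta => _ [n _ <-]; exact: reach_theta.
have I0 : 0 < I.
  apply: (lt_le_trans theta0); apply: lb_le_inf; first by case: hI.
  by move=> _ [n _ <-]; exact: reach_theta.
have Ia n : I <= a n by apply: ge_inf; [by case: hI|exists n].
pose d := I * eps / 2.
have d0 : 0 < d by rewrite /d; apply: divr_gt0 => //; exact: mulr_gt0.
have [_ [n' _ <-] an'] := inf_adherent d0 hI.
have cn' : cylinder (CE (fun S => reach S 0%N%:Z n'%:Z)).
  apply: (@column_event_cylinder N n'.+1); exact: (@local_reach 0 n').
have [q qn' hq] : exists2 q : nat, (n' < q)%N &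
    gibbs beta (cbox Z2_origin q) true (\1_(CE (fun S => reach S 0%N%:Z n'%:Z))) < I + d + d.
  have cv := vol_cvg hm cn'.
  have : \forall q \near \oo, gibbs beta (cbox Z2_origin q) true
      (\1_(CE (fun S => reach S 0%N%:Z n'%:Z))) < I + d + d.
    by apply: cvgr_lt cv _ _; move: an'; rewrite -/(a n') -/I; lra.
  move=> [q0 _ H]; exists (maxn q0 n'.+1); first exact: leq_maxr.
  by apply: H => /=; exact: leq_maxl.
exists q => n qn.
have iA := column_event_incr (N := N) (@incr_reach 0%N%:Z n'%:Z).
have cD : cylinder (CE (fun S => reach S q%:Z n%:Z)).
  apply: (@column_event_cylinder N n.+1); exact: (@local_reach q n).
have Dout (u : config N) (x : vertex N) b : x.1 \in cbox Z2_origin q ->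
    CE (fun S => reach S q%:Z n%:Z) u ->
    CE (fun S => reach S q%:Z n%:Z) (upd u x b).
  rewrite in_vol => xq [y yr yn]; exists y => //; apply: eq_escapes yn => z zq _.
  apply: plus_columns_eq => k; rewrite /upd; case: eqP => // zx.
  by move: zq; rewrite -[z]/((z, k).1) zx xq.
have [_ loc] := prob_local beta0 hm cn' cD iA Dout.
have sub : CE (fun S => reach S 0%N%:Z n%:Z) `<=`
    CE (fun S => reach S 0%N%:Z n'%:Z) `&` CE (fun S => reach S q%:Z n%:Z).
  move=> u un; split.
    by apply: reach_outer un; [|move: qn' qn; clear]; lia.
  by apply: reach_inner un => //; move: qn; clear; lia.
have cn : cylinder (CE (fun S => reach S 0%N%:Z n%:Z)).
  apply: (@column_event_cylinder N n.+1); exact: (@local_reach 0 n).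
have h1 := prob_le hm cn (cylinderI cn' cD) sub.
have p0 := prob_ge0 hm cD; have p1 := prob_le1 hm cD.
have := Ia n; rewrite /a => In.
move: (m (CE (fun S => reach S q%:Z n%:Z))) (gibbs _ _ _ _) p0 p1 loc hq h1 => p g p0 p1 loc hq h1.
have h2 : I <= (I + d + d) * p.
  apply: le_trans In _; apply: le_trans h1 _; apply: le_trans loc _.
  by rewrite ler_wpM2r // ltW.
have h3 : 1 <= (1 + eps) * p.
  rewrite -(ler_pM2l I0) mulr1 mulrA; apply: le_trans h2 _.
  by rewrite ler_wpM2r // /d; lra.
have h4 : eps * p <= eps by rewrite ger_pMr.
by move: h3; rewrite mulrDl mul1r; lra.
Qed.

End ReachHigh.

Lemma prob_union_bound (T : eqType) (r : seq T) (E : T -> set (config N)) (A : set (config N)) (C : R) :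
  cylinder A -> (forall i, cylinder (E i)) ->
  (forall u, (forall i, i \in r -> ~ E i u) -> A u) ->
  (forall i, m (E i) <= C) -> 1 - (size r)%:R * C <= m A.
Proof.
move=> cA cE EA EC.
have lin : \sum_(o <- None :: map Some r)
    (if o is Some _ then -1 else -1) * m (if o is Some i then E i else A) <= -1.
  apply: (prob_lin hm) => [[i|] _ //|u].
  rewrite big_cons big_map /= mulN1r; under eq_bigr do rewrite mulN1r.
  rewrite sumrN -opprD lerN2.
  case: (pselect (A u)) => Au.
    by rewrite indicE mem_set // lerDl; apply: sumr_ge0 => i _; exact: indic_ge0.
  have : ~ (forall i, i \in r -> ~ E i u) by move=> /EA.
  move=> /existsNP[i /not_implyP[ir /contrapT Ei]].
  rewrite (big_rem i) //= [\1_(E i) u]indicE mem_set // addrCA lerDl.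
  by rewrite addr_ge0 ?indic_ge0 // sumr_ge0 // => j _; exact: indic_ge0.
move: lin; rewrite big_cons big_map /= mulN1r; under eq_bigr do rewrite mulN1r.
rewrite sumrN => lin.
have : \sum_(i <- r) m (E i) <= (size r)%:R * C.
  rewrite mulr_natl -iter_addr_0 -(count_predT r) -big_const_seq.
  by apply: ler_sum => i _.
by lra.
Qed.

Lemma prob_bigI_fkg (T : eqType) (r : seq T) (E : T -> set (config N)) :
  (forall i, cylinder (E i)) -> (forall i, decr_event (E i)) ->
  \prod_(i <- r) m (E i) <= m [set u | forall i, i \in r -> E i u].
Proof.
move=> cE dE.
pose A (l : seq T) := [set u | forall i, i \in l -> E i u] : set (config N).
have cA l : cylinder (A l).
  elim: l => [|i l IH]; first by exists fset0 => u v _ _ j; rewrite in_nil.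
  have -> : A (i :: l) = E i `&` A l.
    apply/seteqP; split=> u.
      by move=> h; split; [apply: h; exact: mem_head|move=> j jl; apply: h; rewrite inE jl orbT].
    by move=> [h1 h2] j; rewrite inE => /orP[/eqP -> //|]; exact: h2.
  exact: cylinderI.
have dA l : decr_event (A l) by move=> u v uv h i il; exact: dE uv (h i il).
elim: r => [|i r IH].
  rewrite big_nil; have := prob_setC hm (cA [::]).
  have -> : ~` A [::] = set0 by apply/seteqP; split=> u // h; apply: h => i; rewrite in_nil.
  have : m set0 <= 0.
    have := @prob_lin _ _ _ _ hm bool [:: true] (fun=> 1) (fun=> set0) 0.
    rewrite big_seq1 mul1r; apply=> [_ _|u]; first by exists fset0.
    by rewrite big_seq1 mul1r indicE in_set0.
  by rewrite -/(A [::]); lra.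
rewrite big_cons; have -> : [set u | forall j, j \in i :: r -> E j u] = E i `&` A r.
  apply/seteqP; split=> u.
    by move=> h; split; [apply: h; exact: mem_head|move=> j jl; apply: h; rewrite inE jl orbT].
  by move=> [h1 h2] j; rewrite inE => /orP[/eqP -> //|]; exact: h2.
apply: le_trans (prob_fkg beta0 hm (cE i) (cA r) (dE i) (dA r)).
by apply: ler_wpM2l => //; exact: (prob_ge0 hm).
Qed.

Section Contradiction.
Hypothesis half : forall x : vertex N, m (plus_set x) = 1 / 2.
Variable theta : R.
Hypothesis theta0 : 0 < theta.
Hypothesis reach_theta : forall n : nat, theta <= m (CE (fun S => reach S 0%N%:Z n%:Z)).

Lemma cylinder_arm g (k n : nat) : cylinder (CE (arm g k%:Z n%:Z)).
Proof. apply: (@column_event_cylinder N n.+1); exact: local_arm. Qed.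

Lemma incr_event_arm g k n : incr_event (CE (arm g k n)).
Proof. by apply: column_event_incr; exact: incr_arm. Qed.

(** The square root trick: the eight half sides have equal chances, and
    by positive association a likely union of eight equally likely increasing
    events consists of likely events. *)
Lemma arm_high : exists k : nat, forall n : nat, (k <= n)%N -> forall g,
  1 - 1 / 12 <= m (CE (arm g k%:Z n%:Z)).
Proof.
(* six arms, each missing with probability at most 1/12, leave 1/2 *)
have eps0 : 0 < (1 / 12) ^+ 8 :> R by apply: exprn_gt0; lra.
have [k hk] := reach_high theta0 reach_theta eps0; exists k => n kn g.
have cA g' := cylinder_arm g' k n.
rewrite prob_arm; set a := m _.
have cE g' : cylinder (~` CE (arm g' k%:Z n%:Z)) by exact: cylinderC.
have dE g' : decr_event (~` CE (arm g' k%:Z n%:Z)).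
  by move=> u v uv h /(incr_event_arm uv).
have mE g' : m (~` CE (arm g' k%:Z n%:Z)) = 1 - a by rewrite (prob_setC hm) // prob_arm.
have := prob_bigI_fkg (enum {: bool * bool * bool}) cE dE.
under eq_bigr do rewrite mE.
rewrite big_enum /= prodr_const card_prod card_prod !card_bool.
have cR : cylinder (CE (fun S => reach S k%:Z n%:Z)).
  by apply: (@column_event_cylinder N n.+1); exact: local_reach.
set I := [set u | _] => h1.
have cI : cylinder I.
  exists [fset x in sites (cbox Z2_origin n.+1)]%fset => u v uv uI g' g'T vg'.
  apply: (uI g' g'T); apply: local_arm vg' => z zn; apply: plus_columns_eq => j.
  by rewrite uv // inE mem_sites in_vol.
have h2 : m I <= m (~` CE (fun S => reach S k%:Z n%:Z)).
  apply: (prob_le hm) => //; first exact: cylinderC.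
  by move=> u uI /reach_arm[g' ug']; apply: (uI g') => //; rewrite mem_enum.
rewrite (prob_setC hm) // in h2.
have h3 := hk n kn.
have h4 : (1 - a) ^+ (2 * 2 * 2) <= (1 / 12) ^+ 8.
  by apply: le_trans h1 _; apply: le_trans h2 _; lra.
have a1 : a <= 1 by exact: (prob_le1 hm).
by move: h4; rewrite ler_pXn2r ?nnegrE //; lra.
Qed.

Definition six_arms (k n : int) : set (config N) := [set u |
  (forall g, g \in plus_dirs -> arm g k n (plus_columns u)) /\
  (forall g, g \in minus_dirs -> arm g k n (plus_columns (flip_cfg u)))].

Lemma cylinder_six_arms (k n : nat) : cylinder (six_arms k%:Z n%:Z).
Proof.
exists [fset x in sites (cbox Z2_origin n.+1)]%fset => u v uv [h1 h2].
have uv' z (j : 'I_N) : ball n.+1%:Z z -> u (z, j) = v (z, j).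
  by move=> zn; rewrite uv // inE mem_sites in_vol.
split=> g gd; [apply: local_arm (h1 g gd)|apply: local_arm (h2 g gd)] => z zn;
  by apply: plus_columns_eq => j; rewrite /flip_cfg uv'.
Qed.

Lemma six_arms_high : exists k : nat, forall n : nat, (k <= n)%N ->
  1 / 2 <= m (six_arms k%:Z n%:Z).
Proof.
have [k hk] := arm_high; exists k => n kn.
have cA g := cylinder_arm g k n.
pose E (bg : bool * (bool * bool * bool)) : set (config N) :=
  if bg.1 then ~` CE (arm bg.2 k%:Z n%:Z)
  else @flip_cfg N @^-1` (~` CE (arm bg.2 k%:Z n%:Z)).
pose r := [seq (true, g) | g <- plus_dirs] ++ [seq (false, g) | g <- minus_dirs].
have cE i : cylinder (E i).
  by rewrite /E; case: (i.1); [|apply: cylinder_flip]; exact: cylinderC.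
have mE i : m (E i) <= 1 / 12.
  rewrite /E; case: (i.1); last first.
    rewrite (_ : _ @^-1` _ = ~` (@flip_cfg N @^-1` CE (arm i.2 k%:Z n%:Z))) //.
    rewrite (prob_setC hm); last exact: cylinder_flip.
    rewrite (flip_invariant beta0 hm half (cA _) (@incr_event_arm _ _ _)).
    by have := hk n kn i.2; lra.
  by rewrite (prob_setC hm) //; have := hk n kn i.2; lra.
have := @prob_union_bound _ r E (six_arms k%:Z n%:Z) (1 / 12) (cylinder_six_arms k n) cE.
have -> : 1 - (size r)%:R * (1 / 12) = 1 / 2 :> R by rewrite /r /=; lra.
apply=> // u uE; split=> g gd.
  apply: contrapT => nA; apply: (uE (true, g)); last exact: nA.
  by rewrite mem_cat map_f.
apply: contrapT => nA; apply: (uE (false, g)); last exact: nA.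
by rewrite mem_cat [X in _ || X]map_f ?orbT.
Qed.

Definition full_block (k : nat) : set (config N) :=
  [set u | forall x : vertex N, x.1 \in cbox Z2_origin k -> u x].

(** Finite energy: the six arms do not see the block, which is fully
    occupied with a probability bounded below whatever happens outside. *)
Lemma trifurcation_likely : exists k : nat, exists2 c : R, 0 < c &
  forall n : nat, (k < n)%N -> c <= m (CE (trifurcation k%:Z n%:Z)).
Proof.
have [k hk] := six_arms_high; exists k.
have cF : cylinder (full_block k).
  exists [fset x in sites (cbox Z2_origin k)]%fset => u v uv uF x xk.
  by rewrite -uv ?uF // inE mem_sites.
have iF : incr_event (full_block k) by move=> u v uv uF x xk; apply/uv/uF.
pose c := gibbs beta (cbox Z2_origin k) false (\1_(full_block k)).
have c0 : 0 < c.
  rewrite divr_gt0 ?Z_gt0 //; apply: lt_le_trans (isum_ge_full _ _ _).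
    rewrite indicE mem_set ?mulr1; first exact: weight_gt0.
    by move=> x xk; rewrite mem_sites xk.
  by move=> u; rewrite mulr_ge0 ?indic_ge0 // ltW // weight_gt0.
exists (c / 2); first by rewrite divr_gt0.
move=> n kn.
have Dout (u : config N) (x : vertex N) b : x.1 \in cbox Z2_origin k ->
    six_arms k%:Z n%:Z u -> six_arms k%:Z n%:Z (upd u x b).
  rewrite in_vol => xk.
  have off (v w : config N) : (forall y, ~~ ball k%:Z y.1 -> v y = w y) ->
      forall g, arm g k%:Z n%:Z (plus_columns v) -> arm g k%:Z n%:Z (plus_columns w).
    move=> vw g [y yr yn]; exists y => //; apply: eq_escapes yn => z zk _ /=.
    by apply: plus_columns_eq => j; rewrite vw //= d4_ball.
  have xU (y : vertex N) : ~~ ball k%:Z y.1 -> u y = upd u x b y.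
    by move=> yk; rewrite /upd; case: eqP yk => // ->; rewrite xk.
  move=> [h1 h2]; split=> g gd; first by apply: off (h1 g gd).
  by apply: off (h2 g gd) => y yk; rewrite /flip_cfg xU.
have [loc _] := prob_local beta0 hm cF (cylinder_six_arms k n) iF Dout.
have cT : cylinder (CE (trifurcation k%:Z n%:Z)).
  apply: (@column_event_cylinder N n.+1); exact: local_trifurcation (ltnW kn).
have sub : full_block k `&` six_arms k%:Z n%:Z `<=` CE (trifurcation k%:Z n%:Z).
  move=> u [uF [h1 h2]].
  apply: (@six_arms_trifurcation _ _ _ (plus_columns (flip_cfg u))) => //.
  - by move=> x; exact: plus_minus_columns.
  - move=> z zk; apply: plus_columns_full => // j; apply: uF.
    by rewrite in_vol.
have h := prob_le hm (cylinderI cF (cylinder_six_arms k n)) cT sub.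
apply: le_trans h; apply: le_trans loc; rewrite ler_wpM2l ?(ltW c0) //.
by have := hk n (ltnW kn); rewrite div1r.
Qed.

(** The expected number of trifurcation blocks in a large box is proportional
    to its area, whereas their number is at most that of its boundary points. *)
Lemma no_percolation : False.
Proof.
have [k [c c0 hc]] := trifurcation_likely.
pose L := (2 * k + 1)%N.
(* M blocks per side: n = L * M and 4 * (2 * n + 1) <= 12 * L * M *)
suff bound (M : nat) : (0 < M)%N -> c * M%:R <= (12 * L)%:R.
  pose M := (Num.bound ((12 * L)%:R / c)).+1.
  have := bound M isT; apply/negP; rewrite -ltNge mulrC -ltr_pdivrMr //.
  apply: (@lt_trans _ _ (Num.bound ((12 * L)%:R / c))%:R); last by rewrite ltr_nat.
  by apply: archi_boundP; rewrite divr_ge0 // ltW.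
move=> M0.
pose n := (L * M)%N; pose r := (2 * n)%N.
pose X : seq Z2 := [seq ((L * i)%N%:Z, (L * j)%N%:Z) | i <- iota 0 M, j <- iota 0 M].
have kr : (k < r)%N by rewrite /r /n /L; nia.
have L0 : (0 < L)%N by rewrite /L addn1.
have XP z : z \in X -> exists i j : nat, [/\ (i < M)%N, (j < M)%N & z = ((L * i)%N%:Z, (L * j)%N%:Z)].
  by move=> /allpairsP[[i j] /= [+ + ->]]; rewrite !mem_iota => hi hj; exists i, j; split; [lia|lia|by []].
have uX : uniq X.
  apply: allpairs_uniq; rewrite ?iota_uniq // => -[i j] [i' j'] _ _ /= [].
  by move=> /eqP + /eqP; rewrite !eqn_pmul2l // => /eqP -> /eqP ->.
have sX : size X = (M * M)%N by rewrite size_allpairs size_iota.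
have cT : cylinder (CE (trifurcation k%:Z r%:Z)).
  apply: (@column_event_cylinder N r.+1); exact: local_trifurcation (ltnW kr).
pose E z : set (config N) := [set u | trifurcation k%:Z r%:Z (plus_columns u \o shift z)].
have lin : \sum_(z <- X) 1 * m (E z) <= (4 * (2 * n + 1))%:R.
  apply: (prob_lin hm) => [z _|u]; first exact: (cylinder_move (shift z) cT).
  have -> : \sum_(z <- X) 1 * \1_(E z) u = (size [seq z <- X | u \in E z])%:R :> R.
    rewrite size_filter -sum1_count natr_sum [RHS]big_mkcond /=.
    by apply: eq_bigr => z _; rewrite mul1r indicE; case: (_ \in _).
  rewrite ler_nat; apply: (@block_count (plus_columns u) k%:Z r%:Z n).
  - by [].
  - exact: filter_uniq.
  - by rewrite /r; lia.
  - move=> z; rewrite mem_filter => /andP[_ /XP[i [j [hi hj ->]]]].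
    by rewrite /ball /n /L /=; nia.
  - move=> z z' w; rewrite !mem_filter => /andP[_ /XP[i [j [hi hj ->]]]].
    move=> /andP[_ /XP[i' [j' [hi' hj' ->]]]]; rewrite /ball /unshift /= => h1 h2.
    have -> : i = i' by move: h1 h2; rewrite /L; clear; nia.
    have -> // : j = j' by move: h1 h2; rewrite /L; clear; nia.
  - by move=> z; rewrite mem_filter => /andP[/set_mem].
have : (M * M)%:R * c <= (4 * (2 * n + 1))%:R.
  apply: le_trans lin; rewrite -sX mulr_natl -iter_addr_0 -(count_predT X) -big_const_seq.
  apply: ler_sum => z _; rewrite mul1r.
  by rewrite (@prob_shift z r.+1); [exact: hc|exact: local_trifurcation (ltnW kr)].
move=> h; have Mp : 0 < M%:R :> R by rewrite ltr0n.
rewrite -(ler_pM2r Mp) -mulrA -natrM mulrC; apply: le_trans h _.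
by rewrite -natrM ler_nat /n; nia.
Qed.

End Contradiction.

End Percolation.

(** * The percolation event and the magnetization *)

Section Cluster.
Context {N : nat}.
Variable s : bool.
Implicit Types u : config N.

Definition connects_to (n : nat) : set (config N) := [set u | exists2 y, ~~ ball n%:Z y &
  linked (fun z => signed_column s u z && ball n.+1%:Z z) Z2_origin y].

Definition infinite_cluster : set (config N) := [set u | exists C : set Z2,
  [/\ is_cluster s u C, C Z2_origin & infinite_set C]].

Lemma origin_ball (n : nat) : ball n%:Z Z2_origin.
Proof. by rewrite /ball /=; lia. Qed.

(** Percolation is the decreasing limit of the cylinder events that the origin is
    connected to distance [n]; in particular it is measurable. *)
Lemma infinite_clusterE : infinite_cluster = \bigcap_n connects_to n.
Proof.
apply/seteqP; split=> u.
  move=> [C [[_ CS Cc _] C0 Cinf]] n _.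
  have [v Cv vn] : exists2 v, C v & ~~ ball n%:Z v.
    apply: contrapT => H; apply: Cinf; apply: (@sub_finite_set _ _ [set` cbox Z2_origin n]).
      move=> v Cv /=; rewrite in_vol; apply: contrapT => /negP vn.
      by apply: H; exists v.
    exact: finite_fset.
  have [p [pp lp Cp]] := Cc _ _ C0 Cv.
  have l : linked (signed_column s u) Z2_origin v.
    exists p; split=> //=; apply/andP; split; first exact: CS.
    by apply/allP => w wp; exact/CS/Cp.
  have [a [b [oa ab Sb bn]]] := exit_first l (origin_ball n) vn.
  have [_ /andP[Sa an]] := linked_ends oa.
  have n1 : n%:Z <= n.+1%:Z by lia.
  have b1 : ball n.+1%:Z b by rewrite -[n.+1]addn1; exact: ball_adj an.
  exists b => //; apply: (@linked_trans _ a).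
    by apply: linked_sub oa => z /andP[Sz nz]; rewrite unfold_in Sz; exact: ball_le nz.
  apply: linked_step; rewrite // ?Sa ?Sb //.
  exact: ball_le an.
move=> H; pose C : set Z2 := [set v | linked (signed_column s u) Z2_origin v].
have S0 : signed_column s u Z2_origin.
  by have [y _ /linked_ends[/andP[]]] := H 0%N I.
have C0 : C Z2_origin by exact: linked_refl.
have Cfar n : exists2 y, C y & ~~ ball n%:Z y.
  have [y yn l] := H n I; exists y => //.
  by apply: linked_sub l => z /andP[].
exists C; split=> //; first split.
- by exists Z2_origin.
- by move=> v /linked_ends[].
- move=> v w Cv Cw; have [p [pp lp Sp]] := linked_trans (linked_sym Cv) Cw.
  exists p; split=> // z zp; case/splitPr: zp pp {lp} Sp => p1 p2.
  rewrite -cat_rcons cat_path => /andP[pp1 _] /= /andP[Sv]; rewrite all_cat => /andP[Sp1 _].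
  by apply: linked_trans Cv _; exists (rcons p1 z); rewrite last_rcons /= Sv.
- move=> C' CC' C'S C'c; apply/seteqP; split=> // v C'v.
  have [p [pp lp C'p]] := C'c _ _ (CC' _ C0) C'v.
  exists p; split=> //=; rewrite S0; apply/allP => w wp; exact/C'S/C'p.
move=> /finite_seqP[l Cl].
have [n nP] : exists n : nat, forall x, x \in l -> ball n%:Z x.
  elim: l {Cl} => [|[a b] l [n IH]]; first by exists 0%N.
  exists (n + absz a + absz b)%N => y; rewrite inE => /orP[/eqP ->|/IH].
    by rewrite /ball /=; lia.
  by apply: ball_le; lia.
have [y Cy] := Cfar n; apply/negP; rewrite negbK; apply: nP.
by move: Cy; rewrite Cl.
Qed.

Lemma signed_column_eq u v c : (forall k, u (c, k) = v (c, k)) ->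
  signed_column s u c = signed_column s v c.
Proof.
move=> uv; rewrite /signed_column /column_sum.
by under eq_bigr do rewrite uv.
Qed.

Lemma connects_cylinder n : cylinder (connects_to n).
Proof.
exists [fset x in sites (cbox Z2_origin n.+1)]%fset => u v uv [y yn l].
exists y => //; apply: linked_sub l => z /andP[Sz zn].
rewrite unfold_in zn andbT -(@signed_column_eq u) // => k.
by apply: uv; rewrite inE mem_sites in_vol.
Qed.

Lemma infinite_cluster_prob {R : realType} (mu : probability (config_space N) R) :
  (0 < N_percolation s mu)%E ->
  exists2 theta : R, 0 < theta & forall n, theta <= fine (mu (connects_to n)).
Proof.
rewrite /N_percolation -/infinite_cluster => H.
have mc n : measurable (connects_to n : set (config_space N)).
  exact: cylinder_measurable (connects_cylinder n).
have mI : measurable (infinite_cluster : set (config_space N)).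
  by rewrite infinite_clusterE; apply: bigcapT_measurable.
exists (fine (mu infinite_cluster)).
  by apply: fine_gt0; rewrite H /= ltey_eq fin_num_measure.
move=> n; apply: fine_le; rewrite ?fin_num_measure //.
apply: le_measure; rewrite ?inE //.
by rewrite infinite_clusterE => u; apply.
Qed.

End Cluster.

(** The block of radius 0 is the origin; cut the path where it leaves the origin
    for the last time. *)
Lemma connects_reach {N : nat} (n : nat) :
  connects_to true n `<=` @column_event N (fun S => reach S 0%N%:Z n%:Z).
Proof.
move=> u [y yn l]; have y0 : ~~ ball 0%N%:Z y.
  by apply: contra yn; apply: ball_le; lia.
have [a [b [bY ab _ a0]]] := exit_last l (origin_ball 0) y0.
have [/andP[_ b0] _] := linked_ends bY.
exists b; first exact: ring_adj ab a0 b0.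
exists y => //; apply: linked_sub bY => z /andP[/andP[Sz nz] z0].
by rewrite unfold_in /annulus [plus_columns _ _]Sz z0 /=; move: nz; rewrite -[n.+1]addn1.
Qed.

Lemma magnetizationE {R : realType} {N : nat} (hN : (0 < N)%N)
    (mu : probability (config_space N) R) :
  magnetization hN mu = (2 * fine (mu (plus_set (Z2_origin, Ordinal hN))) - 1)%:E.
Proof.
set A := plus_set _; have cA : cylinder A by exact: plus_set_cylinder.
have mA : measurable (A : set (config_space N)) := cylinder_measurable cA.
have mAC : measurable (~` A : set (config_space N)) by exact: measurableC.
rewrite /magnetization unlock.
have E u : (spin R (u (Z2_origin, Ordinal hN)))%:E
    = ((\1_A u)%:E - (\1_(~` A) u)%:E)%E :> \bar R.
  rewrite indic_setC indicE /spin -EFinB; congr EFin.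
  rewrite (_ : (u \in A) = u (Z2_origin, Ordinal hN)).
    by case: (u _) => /=; lra.
  by apply/idP/idP => [/set_mem //|h]; exact/mem_set.
under eq_integral do rewrite E.
rewrite integralB_EFin //; [|exact: integrable_indic|exact: integrable_indic].
have EC : mu (~` A) = (1 - mu A)%E by exact: probability_setC.
have double (a : \bar R) : a \is a fin_num -> (a - (1 - a))%E = (2 * fine a - 1)%:E.
  by case: a => //= r _; rewrite -!EFinB; congr EFin; lra.
rewrite !integral_indic // !setIT; rewrite [X in (_ - X)%E]EC.
by apply: double; exact: fin_num_measure.
Qed.

Theorem proposition4p3 (R : realType) (N : nat) (hN : (0 < N)%N)
    (beta : R) (hbeta : 0 <= beta)
    (mu_plus mu_minus : probability (config_space N) R)
    (hplus : is_ising_state beta true mu_plus)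
    (hminus : is_ising_state beta false mu_minus) :
  ((0 < N_percolation true mu_plus)%E ->
     (0 < `|magnetization hN mu_plus|)%E) /\
  ((0 < N_percolation false mu_minus)%E ->
     (0 < `|magnetization hN mu_minus|)%E).
Proof.
pose m (A : set (config N)) := fine (mu_plus A).
have hm : infinite_volume beta true m := ising_state_limit hplus.
have hm' := ising_state_limit hminus.
pose x0 : vertex N := (Z2_origin, Ordinal hN).
have c0 := plus_set_cylinder x0.
have minusE A : cylinder A -> fine (mu_minus A) = m (@flip_cfg N @^-1` A).
  move=> cA; have cv := hm' _ (cbox_increase Z2_origin) _ cA.
  have cv' := flip_limit hm (cbox_increase Z2_origin) cA.
  exact: (@cvg_unique _ (@Rhausdorff R) _ _ _ _ cv cv').
have core theta : m (plus_set x0) = 1 / 2 -> 0 < theta ->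
    (forall n, theta <= m (connects_to true n)) -> False.
  move=> half0 th0 thn.
  have half x := half_all hbeta hm x half0.
  apply: (no_percolation hN hbeta hm half th0) => n.
  apply: le_trans (thn n) _; apply: (prob_le hm); last exact: connects_reach.
    exact: connects_cylinder.
  apply: (@column_event_cylinder N n.+1); exact: local_reach.
have zero (r : R) : ~ (0 < `|r%:E|)%E -> r = 0.
  by move=> /negP; rewrite abse_EFin lte_fin normr_gt0 negbK => /eqP.
split=> /infinite_cluster_prob[theta th0 thn]; apply: contrapT;
  rewrite magnetizationE => /zero half0.
  by apply: core th0 thn; move: half0; rewrite -/(m _); lra.
apply: (core theta) => // [|n].
  move: half0; rewrite minusE // flip_plus_set (prob_setC hm) //; lra.
apply: le_trans (thn n) _; rewrite minusE; last exact: connects_cylinder.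
rewrite le_eqVlt; apply/orP; left; apply/eqP; congr m; apply/seteqP; split=> u [y yn l];
  exists y => //; apply: linked_sub l => z.
  by rewrite unfold_in minus_columnsE flip_cfgK.
by rewrite !unfold_in minus_columnsE flip_cfgK.
Qed.
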